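(* Let $n\ge2$ and let $M$ be a smooth, compact, pseudoconvex-oriented CR manifold of dimension $2n+1$ which admits a strictly CR plurisubharmonic function on $(0,1)$-forms. If the real $1$-form $\alpha=-\mathrm{Lie}_T(\gamma)$ is exact on the null space of the Levi form, then for every $\epsilon>0$ there exist a $C^\infty$ real-valued function $\lambda_\epsilon$ on $M$, a purely imaginary vector field $T_\epsilon$ on $M$, and a constant $A_\epsilon>0$ such that $|\lambda_\epsilon|$ and $\gamma(T_\epsilon)$ are bounded uniformly in $\epsilon$, $\gamma(T_\epsilon)$ is bounded away from zero uniformly in $\epsilon$, and $$\langle(\mathcal L_{\lambda_\epsilon}+A_\epsilon\, d\gamma)\lrcorner u,\bar u\rangle\ \ge\ \frac1\epsilon\,|\alpha_\epsilon|^2|u|^2$$ for all $(0,1)$-forms $u$, where $\alpha_\epsilon=-\mathrm{Lie}_{T_\epsilon}(\gamma)$.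
   Context: CR manifolds. A CR manifold of hypersurface type of dimension $2n+1$ is a real smooth manifold $M$ with a complex subbundle $T^{1,0}M\subset\mathbb C TM$ of complex rank $n$ such that $T^{1,0}M\cap T^{0,1}M=\{0\}$, where $T^{0,1}M=\overline{T^{1,0}M}$, and such that the space of smooth local sections of $T^{1,0}M$ is closed under Lie brackets. Fix a Riemannian metric on $M$, extended to a Hermitian metric on $\mathbb CTM$, for which $T^{1,0}M\perp T^{0,1}M$. Locally choose an orthonormal frame $L_1,\dots,L_n,\bar L_1,\dots,\bar L_n,T$ of $\mathbb CTM$ with $L_j$ sections of $T^{1,0}M$ and $T$ purely imaginary (i.e. $\bar T=-T$), orthogonal to $T^{1,0}M\oplus T^{0,1}M$; let $\omega_1,\dots,\omega_n,\bar\omega_1,\dots,\bar\omega_n,\gamma$ be the dual frame of $1$-forms. Levi form. Put $c_{ij}=\gamma([L_i,\bar L_j])$ and $c_{ij}^k=\omega_k([L_i,\bar L_j])$. $M$ is pseudoconvex-oriented if $\gamma$ (hence $T$) is globally defined and the Hermitian matrix $(c_{ij})_{i,j=1}^n$ is positive semidefinite at every point. For a real $C^2$ function $\phi$, its Levi form $\mathcal L_\phi=\frac12(\partial_b\bar\partial_b-\bar\partial_b\partial_b)\phi$ has coefficients $$\phi_{ij}=\tfrac12\Big(L_i\bar L_j\phi+\bar L_jL_i\phi+\sum_k(\overline{c_{ji}^k}\,\bar L_k\phi+c_{ij}^kL_k\phi)\Big).$$ For a $(0,1)$-form $u=\sum_ju_j\bar\omega_j$: $\langle d\gamma\lrcorner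 u,\bar u\rangle=\sum_{i,j}c_{ij}u_i\overline{u_j}$ and $\langle\mathcal L_\phi\lrcorner u,\bar u\rangle=\sum_{i,j}\phi_{ij}u_i\overline{u_j}$. A real-valued $\lambda\in C^\infty(M)$ is strictly CR plurisubharmonic on $(0,1)$-forms if there is $a>0$ with $\langle(\mathcal L_\lambda+d\gamma)\lrcorner u,\bar u\rangle\ge a|u|^2$ for all $u\in C^\infty_{0,1}(M)$. Exactness. The form $\alpha=-\mathrm{Lie}_T(\gamma)$ equals $\sum_j(c_{0j}\omega_j+\overline{c_{0j}}\bar\omega_j)$ with $c_{0j}=\gamma([T,L_j])$. Let $K$ be the set of weakly pseudoconvex points of $M$ (points where $(c_{ij})$ is not positive definite) and, for $z\in K$, let $\mathcal N_z\subset T^{1,0}_zM$ be the null space of the Levi form $(c_{ij}(z))$. $\alpha$ is exact on the null space of the Levi form if there is a smooth real-valued function $h$, defined in a neighborhood of $K$, with $dh(L_z)=\alpha(L_z)$ for all $L_z\in\mathcal N_z$ and all $z\in K$. Norm of $\alpha_\epsilon$. $|\alpha_\epsilon|$ is the pointwise norm of the part of $\alpha_\epsilon$ along $T^{1,0}M\oplus T^{0,1}M$: with $\alpha_{\epsilon,j}=\alpha_\epsilon(L_j)=\gamma([T_\epsilon,L_j])$, $|\alpha_\epsilon|^2=2\sum_{j=1}^n|\alpha_{\epsilon,j}|^2$. *)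

(* Defs.v *)
From HB Require Import structures.
From mathcomp Require Import all_boot all_order all_algebra.
From mathcomp Require Import all_classical all_reals all_analysis.
From mathcomp.real_closed Require Export complex.

Set Implicit Arguments.
Unset Strict Implicit.
Unset Printing Implicit Defensive.

Import Order.TTheory GRing.Theory Num.Theory.
Import numFieldNormedType.Exports.

Local Open Scope classical_set_scope.
Local Open Scope ring_scope.
Local Open Scope complex_scope.

(* Throughout, [0 <= z] on R[i] means that z is real and nonnegative. *)

Section Euclidean.
Context {R : realType} {m : nat}.

Definition partial (i : 'I_m) (f : 'rV[R]_m -> R) (x : 'rV[R]_m) : R :=
  'D_(delta_mx 0 i) f x.

(* Only used for open V, where the germ of f at x \in V is determined by f|V. *)
Fixpoint Ck (k : nat) (V : set 'rV[R]_m) (f : 'rV[R]_m -> R) : Prop :=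
  {in V, continuous f} /\
  if k is k'.+1 then
    forall i, (forall x, V x -> derivable f x (delta_mx 0 i)) /\
              Ck k' V (partial i f)
  else True.

Definition Cinfty (V : set 'rV[R]_m) (f : 'rV[R]_m -> R) := forall k, Ck k V f.

End Euclidean.

(* [cmap] and [cinv] are total, but meaningful only on [cdom] and its image. *)
Record chart (R : realType) (m : nat) (M : topologicalType) := Chart {
  cdom : set M;
  cmap : M -> 'rV[R]_m;
  cinv : 'rV[R]_m -> M;
  cdom_open : open cdom;
  cimg_open : open (cmap @` cdom);
  cmapK : forall p, cdom p -> cinv (cmap p) = p;
  cmap_cont : {in cdom, continuous cmap};
  cinv_cont : {in cmap @` cdom, continuous cinv} }.

(* A smooth structure is presented by an atlas indexed by the points of M,
   with a preferred chart around each point. *)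
Record manifold (R : realType) (m : nat) (M : topologicalType) := Manifold {
  chart_at : M -> chart R m M;
  chart_atP : forall p, cdom (chart_at p) p;
  chart_compat : forall (p q : M) (i : 'I_m),
    Cinfty (cmap (chart_at p) @` (cdom (chart_at p) `&` cdom (chart_at q)))
      (fun x => cmap (chart_at q) (cinv (chart_at p) x) 0 i);
  manifold_hausdorff : hausdorff_space M;
  manifold_second_countable : @second_countable M }.

Section Calculus.
Context {R : realType} {m : nat} {M : topologicalType} (X : manifold R m M).
Local Notation C := R[i].

Definition smooth_on (U : set M) (f : M -> R) : Prop :=
  forall p, Cinfty (cmap (chart_at X p) @` (cdom (chart_at X p) `&` U))
                   (f \o cinv (chart_at X p)).

Definition csmooth_on (U : set M) (f : M -> C) : Prop :=
  smooth_on U (fun p => complex.Re (f p)) /\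
  smooth_on U (fun p => complex.Im (f p)).

Definition cfun (f : M -> R) : M -> C := fun p => (f p)%:C.

(* d f / d x_i at p, in the coordinates x of the chart c *)
Definition chart_partial (c : chart R m M) (i : 'I_m) (f : M -> C) (p : M) : C :=
  partial i (fun x => complex.Re (f (cinv c x))) (cmap c p) +i*
  partial i (fun x => complex.Im (f (cinv c x))) (cmap c p).

Definition coord (c : chart R m M) (k : 'I_m) : M -> C :=
  fun p => (cmap c p 0 k)%:C.

(* The complexified tangent space at p is 'rV[C]_m: a vector v stands for
   \sum_i v_i d/dx_i, with x the coordinates of [chart_at X p]. Complex
   cotangent vectors at p are columns, in the dual basis dx_i. Vector fields and
   1-forms are total functions on M, local ones being restricted to an open set. *)
Definition tangent := 'rV[C]_m.
Definition cotangent := 'cV[C]_m.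
Definition vfield := M -> tangent.
Definition form1 := M -> cotangent.

Definition conjv (v : tangent) : tangent := map_mx Num.conj v.
Definition conjf (Y : vfield) : vfield := fun p => conjv (Y p).

Definition pair (w : cotangent) (v : tangent) : C := (v *m w) 0 0.

(* v f = df(v) for a tangent vector v at p *)
Definition tact (p : M) (v : tangent) (f : M -> C) : C :=
  \sum_i v 0 i * chart_partial (chart_at X p) i f p.

Definition act (Y : vfield) (f : M -> C) : M -> C := fun p => tact p (Y p) f.

(* the components of Y in every chart are smooth *)
Definition smooth_vf (U : set M) (Y : vfield) : Prop :=
  forall q k, csmooth_on (U `&` cdom (chart_at X q))
                         (act Y (coord (chart_at X q) k)).

Definition smooth_form (w : form1) : Prop :=
  forall (U : set M) (Y : vfield), open U -> smooth_vf U Y ->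
    csmooth_on U (fun p => pair (w p) (Y p)).

(* [Y, Z] x_k = Y (Z x_k) - Z (Y x_k) *)
Definition bracket (Y Z : vfield) : vfield := fun p =>
  \row_k (act Y (act Z (coord (chart_at X p) k)) p -
          act Z (act Y (coord (chart_at X p) k)) p).

Definition coord_field (c : chart R m M) (i : 'I_m) : vfield := fun q =>
  \row_k chart_partial c i (coord (chart_at X q) k) q.

(* (Lie_Y w)(d/dx_i) = Y (w (d/dx_i)) - w ([Y, d/dx_i]) *)
Definition lie_form (Y : vfield) (w : form1) : form1 := fun p =>
  \col_i (act Y (fun q => pair (w q) (coord_field (chart_at X p) i q)) p -
          pair (w p) (bracket Y (coord_field (chart_at X p) i) p)).

End Calculus.

Arguments tangent : clear implicits.
Arguments cotangent : clear implicits.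
Arguments vfield : clear implicits.
Arguments form1 : clear implicits.

Record CR_structure (R : realType) (n : nat) (M : topologicalType)
    (X : manifold R n.*2.+1 M) := CRStructure {
  T10 : M -> {vspace 'rV[R[i]]_(n.*2.+1)};
  T10_dim : forall p, \dim (T10 p) = n;
  T10_smooth : forall p, exists (U : set M) (L : 'I_n -> vfield R n.*2.+1 M),
    [/\ open U, U p, forall j, smooth_vf X U (L j) &
        forall q, U q -> basis_of (T10 q) [seq L j q | j : 'I_n]];
  T10_cap_T01 : forall p v, v \in T10 p -> conjv v \in T10 p -> v = 0;
  T10_involutive : forall (U : set M) (Y Z : vfield R n.*2.+1 M), open U ->
    smooth_vf X U Y -> smooth_vf X U Z ->
    (forall p, U p -> Y p \in T10 p) -> (forall p, U p -> Z p \in T10 p) ->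
    forall p, U p -> bracket X Y Z p \in T10 p }.

(* Hermitian extension to C^m of the real bilinear form with matrix G *)
Definition herm (R : realType) (m : nat) (G : 'M[R]_m) (u v : 'rV[R[i]]_m)
    : R[i] :=
  (u *m map_mx (real_complex R) G *m (map_mx Num.conj v)^T) 0 0.

Record CR_metric (R : realType) (n : nat) (M : topologicalType)
    (X : manifold R n.*2.+1 M) (E : CR_structure X) := CRMetric {
  metric : M -> 'M[R]_(n.*2.+1);
  metric_sym : forall p, (metric p)^T = metric p;
  metric_pos : forall p (v : 'rV[R]_(n.*2.+1)), v != 0 ->
    0 < (v *m metric p *m v^T) 0 0;
  metric_smooth : forall (U : set M) (Y Z : vfield R n.*2.+1 M), open U ->
    smooth_vf X U Y -> smooth_vf X U Z ->
    csmooth_on X U (fun p => herm (metric p) (Y p) (Z p));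
  metric_T10_T01 : forall p u v, u \in T10 E p -> v \in T10 E p ->
    herm (metric p) u (conjv v) = 0 }.

Record CR_orientation (R : realType) (n : nat) (M : topologicalType)
    (X : manifold R n.*2.+1 M) (E : CR_structure X) (g : CR_metric E) :=
  CROrientation {
  Tvf : vfield R n.*2.+1 M;
  gam : form1 R n.*2.+1 M;
  Tvf_smooth : smooth_vf X setT Tvf;
  Tvf_imag : forall p, conjv (Tvf p) = - Tvf p;
  Tvf_unit : forall p, herm (metric g p) (Tvf p) (Tvf p) = 1;
  Tvf_T10 : forall p v, v \in T10 E p -> herm (metric g p) (Tvf p) v = 0;
  Tvf_T01 : forall p v, v \in T10 E p -> herm (metric g p) (Tvf p) (conjv v) = 0;
  gam_smooth : smooth_form X gam;
  gam_T : forall p, pair (gam p) (Tvf p) = 1;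
  gam_T10 : forall p v, v \in T10 E p -> pair (gam p) v = 0;
  gam_T01 : forall p v, v \in T10 E p -> pair (gam p) (conjv v) = 0 }.

Definition hquad (R : realType) (n : nat) (c : 'M[R[i]]_n) (u : 'rV[R[i]]_n)
    : R[i] :=
  \sum_i \sum_j c i j * u 0 i * Num.conj (u 0 j).

Definition sqnorm (R : realType) (n : nat) (u : 'rV[R[i]]_n) : R[i] :=
  \sum_j `|u 0 j| ^+ 2.

Section Levi.
Context {R : realType} {n : nat} {M : topologicalType}.
Context {X : manifold R n.*2.+1 M} {E : CR_structure X} {g : CR_metric E}.
Context (S : CR_orientation g).
Local Notation C := R[i].
Local Notation vfield := (vfield R n.*2.+1 M).
Local Notation form1 := (form1 R n.*2.+1 M).

(* A local frame L_1, ..., L_n of T^{1,0}M for which L_j, conj L_j, T is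
   orthonormal, with the forms omega_j of the dual frame. The orthogonality
   relations not listed here are part of [CR_metric] and [CR_orientation]. *)
Record frame := Frame {
  fdom : set M;
  fL : 'I_n -> vfield;
  fomega : 'I_n -> form1;
  fdom_open : open fdom;
  fL_smooth : forall j, smooth_vf X fdom (fL j);
  fL_T10 : forall j p, fdom p -> fL j p \in T10 E p;
  fL_orthonormal : forall i j p, fdom p ->
    herm (metric g p) (fL i p) (fL j p) = (i == j)%:R;
  fomega_L : forall i j p, fdom p -> pair (fomega i p) (fL j p) = (i == j)%:R;
  fomega_Lbar : forall i j p, fdom p -> pair (fomega i p) (conjv (fL j p)) = 0;
  fomega_T : forall i p, fdom p -> pair (fomega i p) (Tvf S p) = 0 }.

Definition fLbar (F : frame) (j : 'I_n) : vfield := conjf (fL F j).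

Definition levi (F : frame) (p : M) : 'M[C]_n :=
  \matrix_(i, j) pair (gam S p) (bracket X (fL F i) (fLbar F j) p).

Definition levi_omega (F : frame) (i j k : 'I_n) (p : M) : C :=
  pair (fomega F k p) (bracket X (fL F i) (fLbar F j) p).

(* Coefficients in the frame F of 1/2 (d_b dbar_b - dbar_b d_b) f; the omega_k
   terms make the sesquilinear form on T^{1,0}M independent of the frame. *)
Definition levi_fun (F : frame) (f : M -> R) (p : M) : 'M[C]_n :=
  \matrix_(i, j) (2%:R^-1 *
    (act X (fL F i) (act X (fLbar F j) (cfun f)) p +
     act X (fLbar F j) (act X (fL F i) (cfun f)) p +
     \sum_k (Num.conj (levi_omega F j i k p) * act X (fLbar F k) (cfun f) p +
             levi_omega F i j k p * act X (fL F k) (cfun f) p))).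

Definition pseudoconvex : Prop :=
  forall (F : frame) p, fdom F p -> forall xi, 0 <= hquad (levi F p) xi.

Definition form01 (u : form1) : Prop :=
  [/\ smooth_form X u, forall p v, v \in T10 E p -> pair (u p) v = 0 &
      forall p, pair (u p) (Tvf S p) = 0].

(* the coefficients u_j of u = \sum_j u_j conj(omega_j) *)
Definition coef01 (F : frame) (u : form1) (p : M) : 'rV[C]_n :=
  \row_j pair (u p) (fLbar F j p).

Definition strictly_CR_psh (lam : M -> R) : Prop :=
  exists2 a : R, 0 < a &
  forall u, form01 u -> forall (F : frame) p, fdom F p ->
    a%:C * sqnorm (coef01 F u p)
      <= hquad (levi_fun F lam p + levi F p) (coef01 F u p).

Definition weakly_pseudoconvex_pt (p : M) : Prop :=
  exists2 F : frame, fdom F p &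
    ~ (forall xi, xi != 0 -> 0 < hquad (levi F p) xi).

Definition levi_null (p : M) (v : tangent R n.*2.+1) : Prop :=
  exists2 F : frame, fdom F p &
  exists2 xi : 'rV[C]_n, v = \sum_i xi 0 i *: fL F i p & xi *m levi F p = 0.

Definition alpha (Y : vfield) : form1 := fun p => - lie_form X Y (gam S) p.

Definition alpha_exact_on_null : Prop :=
  exists (W : set M) (h : M -> R),
    [/\ open W, weakly_pseudoconvex_pt `<=` W, smooth_on X W h &
        forall p, weakly_pseudoconvex_pt p -> forall v, levi_null p v ->
          tact X p v (cfun h) = pair (alpha (Tvf S) p) v].

(* |alpha_Y|^2, the norm of the part of alpha_Y along T10 + T01 *)
Definition alpha_sqnorm (F : frame) (Y : vfield) (p : M) : C :=
  2%:R * \sum_j `|pair (alpha Y p) (fL F j p)| ^+ 2.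

End Levi.

(* Main.v *)
(* Let H be smooth and real, and put T_eps = e^H T + V - conj V with V a section
   of T^{0,1}. By Cartan's formula, alpha_eps(l) = theta(l) - c(l, V) for l in
   T^{1,0}, where theta = e^H (alpha - dH) and c(l, V) = gamma([l, V]) is the Levi
   form. Taking for H the given potential h cut off near the weakly pseudoconvex
   points, theta kills the null space of c at every point. Choose V by Tikhonov
   regularization: c(l, V) + d <l, conj V> = theta(l) for all l in T^{1,0}.
   As c >= 0 and d > 0, the solution is unique, so independent of the frame, and
   smooth, and it leaves alpha_eps(l) = d <l, conj V>. In an orthonormal frame V
   has the coefficients a = (c + d)^-1 theta. At a point p, theta = c w for some w;
   extending w by constants, d |a| <= d |w| + |theta - c w| near p, because both
   d (c + d)^-1 and (c + d)^-1 c are contractions. By compactness alpha_eps is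
   uniformly as small as desired once d is small, and then the given strictly CR
   plurisubharmonic function works as lambda_eps, with A_eps = 1. *)
From HB Require Import structures.
Require Import Defs.
From mathcomp Require Import all_boot all_order all_algebra.
From mathcomp Require Import all_classical all_reals all_analysis.
From mathcomp Require Import ring lra.
Import Order.TTheory GRing.Theory Num.Theory.
Import numFieldNormedType.Exports.
Local Open Scope classical_set_scope.
Local Open Scope ring_scope.
Local Open Scope complex_scope.
Set Implicit Arguments.
Unset Strict Implicit.
Unset Printing Implicit Defensive.

(** * Calculus in coordinates *)

Section DirectionalMVT.
Context {R : realType} {m : nat}.
Implicit Types (f : 'rV[R]_m -> R) (a w x : 'rV[R]_m).

(** Once theta kills the null space of c, the equation c(l, V) = theta(l) is solvable at each point,
    but the rank of c may jump, so solutions need be neither continuous nor bounded in p; the shift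
    by d gives up exactness to gain smoothness. The term - conj V makes T_eps purely imaginary and
    costs nothing: gamma kills V and conj V, and d gamma vanishes on pairs from T^{1,0} by
    involutivity, so only V enters alpha_eps on T^{1,0}. Hence gamma(T_eps) = e^H for every eps, and
    its uniform bounds come from those of H on a compact space. The exponential keeps this factor
    positive, and d(e^H) = e^H dH lets both terms of theta share it, so theta vanishes wherever
    alpha = dH on null vectors. As lambda is fixed and L_lambda + d gamma >= a, the whole claim
    reduces to |alpha_eps|^2 <= eps a. Cartan's formulas replace brackets of fields by the tensor d
    gamma, which can be evaluated on single vectors without a frame. *)

Lemma is_derive_line f a w (t d : R) :
  is_derive (t *: w + a) w f d -> is_derive t 1 (fun s : R => f (s *: w + a)) d.
Proof.
have E : (fun h : R => h^-1 *: (f (h *: w + (t *: w + a)) - f (t *: w + a))) =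
  (fun h : R => h^-1 *: (((fun s : R => f (s *: w + a)) (h *: 1 + t)) - f (t *: w + a))).
  by apply/funext => h; rewrite /= [h *: 1]mulr1 scalerDl addrA.
by move=> [dv dE]; apply: DeriveDef; rewrite ?/derivable -?E // /derive -E.
Qed.

(** Both signs of c are treated, and the intermediate parameter is located only by |s| <= |c|: later
    estimates need just that it stays in a ball. *)
Lemma MVT_line f a w (c : R) :
  (forall s : R, `|s| <= `|c| -> derivable f (s *: w + a) w) ->
  exists2 s : R, `|s| <= `|c| & f (c *: w + a) - f a = c * 'D_w f (s *: w + a).
Proof.
move=> df; set g := fun s : R => f (s *: w + a).
have dg (s : R) : `|s| <= `|c| -> is_derive s 1 g ('D_w f (s *: w + a)).
  by move=> /df /derivableP; apply: is_derive_line.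
have cg (i : interval R) : (forall s : R, s \in i -> `|s| <= `|c|) ->
    {within [set` i], continuous g}.
  by move=> ic; apply: derivable_within_continuous => s /ic /dg [].
have -> : f a = g 0 by rewrite /g scale0r add0r.
rewrite -/(g c); case: (lerP 0 c) => c0.
  have I (s : R) : s \in `[0, c] -> `|s| <= `|c|.
    by rewrite in_itv /= => /andP[s0 sc]; rewrite !ger0_norm.
  case: (@MVT_segment R g (fun s => 'D_w f (s *: w + a)) 0 c c0).
  - by move=> s sI; apply/dg/I; apply: subset_itv_oo_cc.
  - exact: cg.
  by move=> s /I sI; rewrite subr0 mulrC => ->; exists s.
have I (s : R) : s \in `[c, 0] -> `|s| <= `|c|.
  by rewrite in_itv /= => /andP[cs s0]; rewrite (ler0_norm s0) (ltr0_norm c0) lerN2.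
case: (@MVT_segment R g (fun s => 'D_w f (s *: w + a)) c 0 (ltW c0)).
- by move=> s sI; apply/dg/I; apply: subset_itv_oo_cc.
- exact: cg.
move=> s /I sI E; exists s => //; rewrite -opprB E; ring.
Qed.

Lemma partial_is_derive f x i : derivable f x (delta_mx 0 i) ->
  is_derive x (delta_mx 0 i) f (partial i f x).
Proof. exact: derivableP. Qed.

(** Walk from x to h + x one axis at a time: by the mean value theorem each leg changes f by h_k
    times a partial derivative at a nearby point, which continuity compares with the one at x. *)
Lemma C1_linear_approx (V : set 'rV[R]_m) f x : open V -> V x ->
  (forall i y, V y -> derivable f y (delta_mx 0 i)) ->
  (forall i, {in V, continuous (partial i f)}) ->
  forall e : R, 0 < e -> \forall h \near (0 : 'rV[R]_m),
    `|f (h + x) - f x - \sum_i h 0 i * partial i f x| <= e * `|h|.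
Proof.
move=> oV Vx df cf e e0.
(* Each of the m legs contributes at most e' * |h|; the divisor m + 1 stays nonzero when m = 0. *)
pose e' := e / m.+1%:R.
have e'0 : 0 < e' by rewrite divr_gt0 ?ltr0Sn.
have Hnear : \forall y \near x, V y /\ forall i, `|partial i f y - partial i f x| <= e'.
  have cfx i : \forall y \near x, `|partial i f y - partial i f x| <= e'.
    have /cvgrPdist_le/(_ e' e'0) := cf i x (mem_set Vx).
    by apply: filterS => y; rewrite distrC.
  by near=> y; split; [near: y; exact: open_nbhs_nbhs|near: y; exact: filter_forall cfx].
have [r /= r0 Hr] := (nbhs_ballP x _).1 Hnear.
apply/nbhs_ballP; exists r => //= h.
rewrite -ball_normE /= add0r normrN => hr.
(* [tr k] keeps the first k coordinates of h, so that [tr k] and [tr k.+1] differ along a single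
   axis. *)
pose tr k : 'rV[R]_m := \row_i (if (i < k)%N then h 0 i else 0).
have tr0 : tr 0 = 0 by apply/rowP => i; rewrite !mxE.
have trm : tr m = h by apply/rowP => i; rewrite !mxE ltn_ord.
have trS (k : 'I_m) : tr k.+1 = h 0 k *: delta_mx 0 k + tr k.
  apply/rowP => i; rewrite !mxE eqxx /= ltnS leq_eqVlt.
  case: (eqVneq i k) => [->|ik]; first by rewrite eqxx /= ltnn mulr1 addr0.
  by rewrite (inj_eq val_inj) (negPf ik) mulr0 add0r.
have -> : f (h + x) - f x = \sum_(k < m) (f (tr k.+1 + x) - f (tr k + x)).
  rewrite -(big_mkord predT (fun k => f (tr k.+1 + x) - f (tr k + x))).
  by rewrite telescope_sumr // trm tr0 add0r.
rewrite -sumrB; apply: (le_trans (ler_norm_sum _ _ _)).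
have bound (k : 'I_m) : `|f (tr k.+1 + x) - f (tr k + x) - h 0 k * partial k f x| <= e' * `|h|.
  have hk : `|h 0 k| <= `|h|.
    rewrite [leRHS]/Num.Def.normr/= mx_normrE.
    exact: (le_bigmax _ (fun i : 'I_1 * 'I_m => `|h i.1 i.2|) (0, k)).
  (* The leg stays in the ball because the norm is the maximum norm and each coordinate of the
     displacement is bounded by one of h. *)
  have inb (s : R) : `|s| <= `|h 0 k| -> ball x r (s *: delta_mx 0 k + (tr k + x)).
    move=> sk; rewrite -ball_normE /= addrA opprD addrCA subrr addr0 normrN; apply: le_lt_trans hr.
    rewrite [leLHS]/Num.Def.normr/= mx_normrE; apply: bigmax_le => // -[i j] _ /=.
    rewrite !mxE ord1 eqxx /=.
    have hj : `|h 0 j| <= `|h|.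
      rewrite [leRHS]/Num.Def.normr/= mx_normrE.
      exact: (le_bigmax _ (fun i : 'I_1 * 'I_m => `|h i.1 i.2|) (0, j)).
    case: (eqVneq j k) => [->|jk]; first by rewrite ltnn mulr1 addr0 (le_trans sk).
    by rewrite mulr0 add0r; case: ifP => // _; rewrite normr0.
  rewrite trS -[_ + tr k + x]addrA.
  have [|s sk ->] := @MVT_line f (tr k + x) (delta_mx 0 k) (h 0 k).
    by move=> s /inb /Hr [Vs _]; exact: df.
  rewrite -mulrBr normrM mulrC ler_pM //.
  by have [_ /(_ k)] := Hr _ (inb _ sk).
apply: (le_trans (ler_sum _ (fun k _ => bound k))).
rewrite sumr_const card_ord -mulr_natr /e'.
have -> : e / m.+1%:R * `|h| * m%:R = (e * `|h|) * (m%:R / m.+1%:R) by ring.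
apply: ler_piMr; first by rewrite mulr_ge0 ?(ltW e0).
by rewrite ler_pdivrMr ?ltr0Sn // mul1r ler_nat.
Unshelve. all: by end_near. Qed.

End DirectionalMVT.

(** * Differentiability of C^1 functions and the chain rule *)

Section Chain.
Context {R : realType} {m : nat}.

Lemma C1_differentiable (V : set 'rV[R]_m) (f : 'rV[R]_m -> R) x :
  open V -> V x ->
  (forall i y, V y -> derivable f y (delta_mx 0 i)) ->
  (forall i, {in V, continuous (partial i f)}) ->
  differentiable f x.
Proof.
move=> oV Vx df cf.
pose d (h : 'rV[R]_m) : R := \sum_i h 0 i * partial i f x.
have lin_d : linear d.
  move=> a u v; rewrite /d scaler_sumr -big_split /=; apply: eq_bigr => i _.
  by rewrite !mxE mulrDl -mulrA.
pose dM := GRing.isLinear.Build _ _ _ _ _ lin_d.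
pose dL : {linear _ -> _} := HB.pack d dM.
have cd : continuous d.
  rewrite /d; apply: continuous_big => [|i _]; first exact: add_continuous.
  by move=> h; exact: (cvgMr_tmp (@coord_continuous _ _ _ 0 i h)).
have E : f \o shift x = cst (f x) + dL +o_ (0 : 'rV[R]_m) id.
  apply/eqaddoP => e e0.
  have := C1_linear_approx oV Vx df cf e0.
  by apply: filterS => h /= H; rewrite /= opprD addrA.
have dE := @diff_unique _ _ _ f dL x cd E.
by apply/diff_locallyP; rewrite dE.
Qed.

Lemma derive_line (W : normedModType R) (F : 'rV[R]_m -> W) x v :
  'D_v F x = 'D_1 (fun t : R => F (t *: v + x)) 0.
Proof.
rewrite /derive; set g1 := fun h => h^-1 *: _; set g2 := fun h => h^-1 *: _.
suff -> : g1 = g2 by [].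
by apply/funext => h; rewrite /g1 /g2 /= addr0 scale0r add0r [_%:A]mulr1.
Qed.

(** Only the derivative of phi along v is available, so the differential of g is composed with the
    curve t |-> phi (t v + x), which is differentiable at 0. *)
Lemma is_derive_comp {m'} (g : 'rV[R]_m' -> R) (phi : 'rV[R]_m -> 'rV[R]_m') x v :
  differentiable g (phi x) ->
  (forall j, derivable (fun y => phi y 0 j) x v) ->
  is_derive x v (g \o phi) (\sum_j 'D_v (fun y => phi y 0 j) x * partial j g (phi x)).
Proof.
move=> dg dphi.
have dp : derivable phi x v.
  by apply/derivable_mxP => i j; rewrite (ord1 i).
pose psi (t : R) := phi (t *: v + x).
have psi0 : psi 0 = phi x by rewrite /psi scale0r add0r.
have dpsi : differentiable psi (0 : R) by apply/derivable1_diffP; exact: (iffLR (derivable1P _ _ _)).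
have dg0 : differentiable g (psi 0) by rewrite psi0.
have dgpsi : differentiable (g \o psi) (0 : R) by exact: differentiable_comp.
apply: DeriveDef.
  exact: (iffRL (derivable1P _ _ _) (iffRL (derivable1_diffP _ _) dgpsi)).
rewrite derive_line -[LHS]/('D_1 (g \o psi) (0 : R)) deriveE // diff_comp //= psi0.
have -> : 'd psi (0 : R) 1 = 'D_v phi x by rewrite -deriveE // derive_line.
rewrite derive_mx // [X in 'd g _ X]row_sum_delta linear_sum /=; apply: eq_bigr => j _.
by rewrite linearZ /= -deriveE // mxE.
Qed.

End Chain.

(** * Closure properties of the class C^k on open sets *)

Section CkTheory.
Context {R : realType} {m : nat}.
Implicit Types (V U : set 'rV[R]_m) (f g : 'rV[R]_m -> R).

Lemma Ck_continuous k V f : Ck k V f -> {in V, continuous f}.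
Proof. by case: k => [|k] []. Qed.

Lemma CkS k V f : Ck k.+1 V f -> Ck k V f.
Proof.
elim: k V f => [|k IH] V f [cf Hf]; first by [].
by split=> // i; have [df /IH] := Hf i.
Qed.

Lemma Ck_derivable k V f i x : Ck k.+1 V f -> V x -> derivable f x (delta_mx 0 i).
Proof. by move=> [_ /(_ i)[df _]]; exact: df. Qed.

Lemma Ck_partial k V f (i : 'I_m) : Ck k.+1 V f -> Ck k V (partial i f).
Proof. by move=> [_ /(_ i)[]]. Qed.

Lemma Ck_subset k U V f : U `<=` V -> Ck k V f -> Ck k U f.
Proof.
move=> UV; elim: k f => [|k IH] f [cf Hf].
  by split=> // x /set_mem /UV /mem_set; exact: cf.
split=> [x /set_mem /UV /mem_set|i]; first exact: cf.
by have [df /IH] := Hf i; split=> // x /UV; exact: df.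
Qed.

Lemma Ck_local k V f :
  (forall x, V x -> exists2 U, U x & Ck k U f) -> Ck k V f.
Proof.
elim: k f => [|k IH] f H.
  by split=> // x /set_mem /H [U Ux [cf _]]; apply: cf; exact: mem_set.
split=> [x /set_mem /H [U Ux [cf _]]|i]; first by apply: cf; exact: mem_set.
split=> [x /H [U Ux /Ck_derivable]|]; first exact.
by apply: IH => x /H [U Ux /Ck_partial HU]; exists U.
Qed.

Lemma near_open_eq V f g x : open V -> V x ->
  (forall y, V y -> f y = g y) -> {near x, f =1 g}.
Proof.
move=> oV Vx fg; near=> y; apply: fg; near: y; exact: open_nbhs_nbhs.
Unshelve. all: by end_near. Qed.

Lemma partial_ext V f g i x : open V -> V x ->
  (forall y, V y -> f y = g y) -> partial i f x = partial i g x.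
Proof. by move=> oV Vx fg; apply: near_eq_derive; exact: (near_open_eq oV Vx fg). Qed.

Lemma near_continuous (T T' : topologicalType) (u v : T -> T') x :
  {near x, u =1 v} -> {for x, continuous u} -> {for x, continuous v}.
Proof.
move=> uv cu; have uvx : u x = v x := nbhs_singleton uv.
rewrite /prop_for /continuous_at -uvx.
apply: cvg_trans cu; apply: near_eq_cvg.
by apply: filterS uv => y ->.
Qed.

Lemma Ck_ext k V f g : open V -> (forall x, V x -> f x = g x) -> Ck k V f -> Ck k V g.
Proof.
move=> oV; elim: k f g => [|k IH] f g fg [cf Hf].
  split=> // x /set_mem Vx.
  exact: near_continuous (near_open_eq oV Vx fg) (cf x (mem_set Vx)).
split=> [x /set_mem Vx|i].
  exact: near_continuous (near_open_eq oV Vx fg) (cf x (mem_set Vx)).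
have [df Cf] := Hf i; split=> [x Vx|].
  apply: near_eq_derivable (df _ Vx); exact: (near_open_eq oV Vx fg).
apply: IH Cf => x Vx; exact: partial_ext fg.
Qed.

Lemma Ck_cst k V (a : R) : Ck k V (fun=> a).
Proof.
elim: k a => [|k IH] a; first by split=> // x _; exact: cst_continuous.
split=> [x _|i]; first exact: cst_continuous.
split=> [x _|]; first exact: derivable_cst.
have -> : partial i (fun=> a) = (fun=> 0 : R) by apply/funext => x; exact: derive_cst.
exact: IH.
Qed.

Lemma Ck_add k V f g : open V -> Ck k V f -> Ck k V g -> Ck k V (fun x => f x + g x).
Proof.
move=> oV; elim: k f g => [|k IH] f g [cf Hf] [cg Hg].
  by split=> // x Vx; exact: (cvgD (cf x Vx) (cg x Vx)).
split=> [x Vx|i]; first exact: (cvgD (cf x Vx) (cg x Vx)).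
have [df Cf] := Hf i; have [dg Cg] := Hg i.
split=> [x Vx|]; first by apply: derivableD; [exact: df|exact: dg].
apply: Ck_ext (IH _ _ Cf Cg) => // x Vx; rewrite /partial.
by rewrite (deriveD (df _ Vx) (dg _ Vx)).
Qed.

Lemma Ck_mul k V f g : open V -> Ck k V f -> Ck k V g -> Ck k V (fun x => f x * g x).
Proof.
move=> oV; elim: k f g => [|k IH] f g Cf Cg.
  by split=> // x Vx; exact: (cvgM (Ck_continuous Cf Vx) (Ck_continuous Cg Vx)).
split=> [x Vx|i].
  by exact: (cvgM (Ck_continuous Cf Vx) (Ck_continuous Cg Vx)).
split=> [x Vx|].
  by apply: derivableM; [exact: Ck_derivable Cf Vx|exact: Ck_derivable Cg Vx].
have H := Ck_add oV (IH _ _ (CkS Cf) (Ck_partial i Cg)) (IH _ _ (CkS Cg) (Ck_partial i Cf)).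
apply: Ck_ext H => // x Vx; rewrite /partial.
by rewrite (deriveM (Ck_derivable Cf Vx) (Ck_derivable Cg Vx)).
Qed.

Lemma Ck_opp k V f : open V -> Ck k V f -> Ck k V (fun x => - f x).
Proof.
move=> oV Cf; apply: (Ck_ext oV _ (Ck_mul oV (Ck_cst k V (- 1)) Cf)) => x Vx.
by rewrite mulN1r.
Qed.

Lemma Ck_sum k V (I : Type) (s : seq I) (F : I -> 'rV[R]_m -> R) : open V ->
  (forall i, Ck k V (F i)) -> Ck k V (fun x => \sum_(i <- s) F i x).
Proof.
move=> oV CF; elim: s => [|i s IH].
  by apply: Ck_ext (Ck_cst k V 0) => // x _; rewrite big_nil.
by apply: Ck_ext (Ck_add oV (CF i) IH) => // x _; rewrite big_cons.
Qed.

Lemma partial_coord i j x : is_derive x (delta_mx 0 i) (fun y : 'rV[R]_m => y 0 j) (i == j)%:R.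
Proof.
have dl : derivable (id : 'rV[R]_m -> 'rV[R]_m) x (delta_mx 0 i) by exact: derivable_id.
apply: DeriveDef; first by move: dl => /derivable_mxP; exact.
have := derive_id x (delta_mx 0 i); rewrite (derive_mx dl) => /rowP/(_ j).
by rewrite !mxE eqxx /= eq_sym.
Qed.

(* One step of the induction proving that [s \o f] is as smooth as [f]. *)
Lemma Ck_comp1 k V f (s s' : R -> R) : open V ->
  (forall x, V x -> is_derive (f x) 1 s (s' (f x))) ->
  Ck k.+1 V f -> Ck k V (s' \o f) -> Ck k.+1 V (s \o f).
Proof.
move=> oV ds Cf Cs'.
have dd i x : V x -> is_derive x (delta_mx 0 i) (s \o f) (s' (f x) * partial i f x).
  move=> Vx; have dfx := Ck_derivable Cf Vx.
  have [dsx sE] := ds _ Vx.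
  pose F (t : R) := f (t *: delta_mx 0 i + x).
  have F0 : F 0 = f x by rewrite /F scale0r add0r.
  have dF : derivable F 0 1 by exact: (iffLR (derivable1P _ _ _)).
  have dsF : derivable s (F 0) 1 by rewrite F0.
  apply: DeriveDef.
    apply: (iffRL (derivable1P _ _ _)); apply: (iffRL (derivable1_diffP _ _)).
    by apply: (@differentiable_comp _ _ _ _ F s); apply/derivable1_diffP.
  rewrite derive_line -[LHS]/('D_1 (s \o F) (0 : R)) -derive1E derive1_comp //.
  by rewrite F0 !derive1E sE /partial derive_line.
split=> [x /set_mem Vx|i].
  apply: (@continuous_comp _ _ _ f s); first exact: (Ck_continuous Cf (mem_set Vx)).
  apply: differentiable_continuous; apply/derivable1_diffP.
  by have [] := ds _ Vx.
split=> [x Vx|]; first by have [] := dd i x Vx.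
apply: Ck_ext (Ck_mul oV Cs' (Ck_partial i Cf)) => // x Vx.
by have [_ E] := dd i x Vx; rewrite [RHS]E.
Qed.

Lemma Ck_comp_continuous V f (s : R -> R) :
  {in V, continuous f} -> (forall x, V x -> {for f x, continuous s}) -> Ck 0 V (s \o f).
Proof.
move=> cf cs; split=> // x Vx; apply: continuous_comp; first exact: cf.
by apply: cs; exact: set_mem.
Qed.

(** The derivative - y ^- 2 is a polynomial in the inverse, so the induction hypothesis on k covers
    it. The exponential and the square root have the same self-reproducing derivatives. *)
Lemma Ck_inv k V f : open V -> (forall x, V x -> f x != 0) ->
  Ck k V f -> Ck k V (fun x => (f x)^-1).
Proof.
move=> oV f0; elim: k => [|k IH] Cf.
  apply: Ck_comp_continuous; first exact: Ck_continuous Cf.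
  by move=> x /f0; exact: inv_continuous.
apply: (@Ck_comp1 _ _ _ _ (fun y => - y ^- 2)) => //.
  move=> x /f0 fx; apply: (is_derive_eq (is_deriveV fx (is_derive_id _ _))).
  by rewrite [_ *: _]mulr1.
have H := IH (CkS Cf).
apply: Ck_ext (Ck_opp oV (Ck_mul oV H H)) => // x Vx.
by rewrite /= -exprVn expr2.
Qed.

Lemma Ck_expR k V f : open V -> Ck k V f -> Ck k V (fun x => expR (f x)).
Proof.
move=> oV; elim: k => [|k IH] Cf.
  apply: Ck_comp_continuous; first exact: Ck_continuous Cf.
  by move=> x _; exact: continuous_expR.
apply: (@Ck_comp1 _ _ _ _ expR) => //; exact: (IH (CkS Cf)).
Qed.

Lemma Ck_sqrt k V f : open V -> (forall x, V x -> 0 < f x) ->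
  Ck k V f -> Ck k V (fun x => Num.sqrt (f x)).
Proof.
move=> oV f0; elim: k => [|k IH] Cf.
  apply: Ck_comp_continuous; first exact: Ck_continuous Cf.
  by move=> x _; exact: sqrt_continuous.
apply: (@Ck_comp1 _ _ _ _ (fun y => (2 * Num.sqrt y)^-1)) => //.
  by move=> x /f0; exact: is_derive1_sqrt.
apply: Ck_inv => //; last by apply: Ck_mul; [|exact: Ck_cst|exact: IH (CkS Cf)].
by move=> x /f0 fx; rewrite mulf_neq0 // ?pnatr_eq0 // gt_eqF // sqrtr_gt0.
Qed.

End CkTheory.

Section CkComposition.
Context {R : realType} {m m' : nat}.

(** By the chain rule the partial derivatives are sums of products of partial derivatives of phi,
    smooth by hypothesis, with [partial j g \o phi], covered by induction. *)
Lemma Ck_comp k (V : set 'rV[R]_m) (V' : set 'rV[R]_m')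
    (g : 'rV[R]_m' -> R) (phi : 'rV[R]_m -> 'rV[R]_m') :
  open V -> open V' -> (forall x, V x -> V' (phi x)) ->
  {in V, continuous phi} ->
  (forall j, Cinfty V (fun x => phi x 0 j)) ->
  Ck k V' g -> Ck k V (g \o phi).
Proof.
move=> oV oV' sV cphi Cphi; elim: k g => [|k IH] g Cg.
  split=> // x Vx; apply: continuous_comp; first exact: cphi.
  by apply: (Ck_continuous Cg); apply/mem_set/sV/set_mem.
split=> [x Vx|i].
  apply: continuous_comp; first exact: cphi.
  by apply: (Ck_continuous Cg); apply/mem_set/sV/set_mem.
have dd x : V x -> is_derive x (delta_mx 0 i) (g \o phi)
    (\sum_j partial i (fun y => phi y 0 j) x * partial j g (phi x)).
  move=> Vx; apply: is_derive_comp => [|j].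
    apply: (C1_differentiable oV' (sV _ Vx)) => j.
      by move=> y V'y; exact: Ck_derivable Cg V'y.
    exact: Ck_continuous (Ck_partial j Cg).
  exact: Ck_derivable (Cphi j 1%N) Vx.
split=> [x Vx|]; first by have [] := dd x Vx.
have H : Ck k V (fun x => \sum_j partial i (fun y => phi y 0 j) x * partial j g (phi x)).
  apply: Ck_sum => // j; apply: Ck_mul => //; first exact: Ck_partial (Cphi j k.+1).
  exact: IH (Ck_partial j Cg).
by apply: Ck_ext H => // x Vx; have [_] := dd x Vx.
Qed.

End CkComposition.

(** * Symmetry of second derivatives *)

Section Schwarz.
Context {R : realType} {m : nat}.
Implicit Types (V : set 'rV[R]_m) (f : 'rV[R]_m -> R).

Lemma is_derive_translate f (c y w : 'rV[R]_m) (d : R) :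
  is_derive (c + y) w f d -> is_derive y w (fun z => f (c + z)) d.
Proof.
have E : (fun h : R => h^-1 *: (f (h *: w + (c + y)) - f (c + y))) =
  (fun h : R => h^-1 *: ((fun z => f (c + z)) (h *: w + y) - f (c + y))).
  by apply/funext => h; rewrite /= addrCA.
by move=> [dv dE]; apply: DeriveDef; rewrite ?/derivable -?E // /derive -E.
Qed.

(** The mean value theorem is used twice: along axis i for y |-> f (y + s e_j) - f y, then along
    axis j for [partial i f]. The left side is symmetric in i and j, the right side is not. *)
Lemma second_difference V f i j x (s : R) : Ck 2 V f ->
  (forall a b : R, `|a| <= `|s| -> `|b| <= `|s| ->
    V (b *: delta_mx 0 j + (a *: delta_mx 0 i + x))) ->
  exists a b : R, [/\ `|a| <= `|s|, `|b| <= `|s| &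
    f (s *: delta_mx 0 j + (s *: delta_mx 0 i + x)) - f (s *: delta_mx 0 i + x) -
    (f (s *: delta_mx 0 j + x) - f x) =
    s * (s * partial j (partial i f) (b *: delta_mx 0 j + (a *: delta_mx 0 i + x)))].
Proof.
move=> Cf HV.
have s0 : `|0 : R| <= `|s| by rewrite normr0.
have HV0 a : `|a| <= `|s| -> V (a *: delta_mx 0 i + x).
  by move=> /HV/(_ s0); rewrite scale0r add0r.
pose phi y := f (s *: delta_mx 0 j + y) - f y.
have dphi (a : R) : `|a| <= `|s| ->
    is_derive (a *: delta_mx 0 i + x) (delta_mx 0 i) phi
      (partial i f (s *: delta_mx 0 j + (a *: delta_mx 0 i + x)) -
       partial i f (a *: delta_mx 0 i + x)).
  move=> a_s; apply: is_deriveB.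
    by apply/is_derive_translate/partial_is_derive/(Ck_derivable Cf)/HV.
  exact/partial_is_derive/(Ck_derivable Cf)/HV0.
have [a sa Ea] : exists2 a : R, `|a| <= `|s| & phi (s *: delta_mx 0 i + x) - phi x =
    s * 'D_(delta_mx 0 i) phi (a *: delta_mx 0 i + x).
  by apply: MVT_line => a /dphi [].
have [b sb Eb] : exists2 b : R, `|b| <= `|s| &
    partial i f (s *: delta_mx 0 j + (a *: delta_mx 0 i + x)) -
      partial i f (a *: delta_mx 0 i + x) =
    s * 'D_(delta_mx 0 j) (partial i f) (b *: delta_mx 0 j + (a *: delta_mx 0 i + x)).
  by apply: MVT_line => b sb; apply: (Ck_derivable (Ck_partial i Cf)); exact: HV.
exists a, b; split=> //.
rewrite -[LHS]/(phi _ - phi x) Ea; congr (_ * _).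
by have [_ ->] := dphi _ sa; rewrite Eb.
Qed.

(** One second difference, read in both orders, makes the two mixed derivatives agree at two points
    close to x; continuity of each carries this to x up to e. *)
Lemma partial_comm V f i j x : open V -> V x -> Ck 2 V f ->
  partial i (partial j f) x = partial j (partial i f) x.
Proof.
move=> oV Vx Cf.
apply/eqP; rewrite -subr_eq0 -normr_le0; apply/ler_addgt0Pr => e e0; rewrite add0r.
pose A := partial i (partial j f); pose B := partial j (partial i f).
have e20 : 0 < e / 2 by rewrite divr_gt0.
have cA : {for x, continuous A}.
  exact: (Ck_continuous (Ck_partial i (Ck_partial j Cf)) (mem_set Vx)).
have cB : {for x, continuous B}.
  exact: (Ck_continuous (Ck_partial j (Ck_partial i Cf)) (mem_set Vx)).
have HA := (cvgrPdist_le _ _).1 cA _ e20.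
have HB := (cvgrPdist_le _ _).1 cB _ e20.
have NV : nbhs x V by exact: open_nbhs_nbhs.
have HN : nbhs x (V `&` ([set y | `|A x - A y| <= e / 2] `&` [set y | `|B x - B y| <= e / 2])).
  exact: (filterI NV (filterI (HA _) (HB _))).
have [r /= r0 Hr] := (nbhs_ballP _ _).1 HN.
(* Two axis steps of length at most s move a point by at most 2 s < r. *)
pose s := r / 3.
have s0 : 0 < s by rewrite divr_gt0.
have inb (a b : R) p q : `|a| <= `|s| -> `|b| <= `|s| ->
    ball x r (b *: delta_mx 0 p + (a *: delta_mx 0 q + x)).
  move=> sa sb; rewrite -ball_normE /= addrA opprD addrCA subrr addr0 normrN.
  have -> : r = s + s + s by rewrite /s; lra.
  rewrite -(gtr0_norm s0).
  apply: (@le_lt_trans _ _ (`|s| + `|s|)); last first.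
    by rewrite ltrDl normr_gt0 gt_eqF.
  have nd c t : `|c *: delta_mx 0 t : 'rV[R]_m| <= `|c|.
    rewrite normrZ ler_piMr //.
    rewrite [leLHS]/Num.Def.normr/= mx_normrE; apply: bigmax_le => // k _ /=.
    by rewrite mxE; case: (_ && _); rewrite ?normr1 ?normr0.
  apply: (le_trans (ler_normD _ _)); apply: lerD; exact: (le_trans (nd _ _)).
have [|a [b [sa sb E1]]] := @second_difference V f i j x s Cf.
  by move=> a b sa sb; have [] := Hr _ (inb a b j i sa sb).
have [|c [d [sc sd E2]]] := @second_difference V f j i x s Cf.
  by move=> c d sc sd; have [] := Hr _ (inb c d i j sc sd).
rewrite -/(A x) -/(B x).
rewrite -/(B _) in E1; rewrite -/(A _) in E2; clearbody A B.
have : s * (s * B (b *: delta_mx 0 j + (a *: delta_mx 0 i + x))) =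
       s * (s * A (d *: delta_mx 0 i + (c *: delta_mx 0 j + x))).
  have swap (a1 a2 a3 a4 : R) : a1 - a2 - (a3 - a4) = a1 - a3 - (a2 - a4) by ring.
  apply: (etrans (esym E1)); apply: (etrans _ E2).
  by rewrite [in RHS]addrCA; exact: swap.
move=> /(mulfI (lt0r_neq0 s0)) /(mulfI (lt0r_neq0 s0)) EAB.
have [_ [_ HB1]] := Hr _ (inb a b j i sa sb).
have [_ [HA1 _]] := Hr _ (inb c d i j sc sd).
have -> : A x - B x = (A x - A (d *: delta_mx 0 i + (c *: delta_mx 0 j + x))) -
  (B x - B (b *: delta_mx 0 j + (a *: delta_mx 0 i + x))) by rewrite EAB opprB addrA subrK.
rewrite (splitr e); apply: (le_trans (ler_normB _ _)).
exact: lerD.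
Qed.

End Schwarz.

(** * The flat function exp(-1/x) *)

Section FlatFunction.
Context {R : realType}.
Implicit Types (x : R) (k : nat).

(* [flat 0] is the standard flat function; the powers [x ^- k] make the family
   closed under differentiation up to linear combinations. *)
Definition flat k x : R := if 0 < x then x ^- k * expR (- x^-1) else 0.

Lemma flat_gt0 k x : 0 < x -> 0 < flat k x.
Proof. by move=> x0; rewrite /flat x0 mulr_gt0 ?expR_gt0 // invr_gt0 exprn_gt0. Qed.

Lemma flat_le0 k x : x <= 0 -> flat k x = 0.
Proof. by move=> x0; rewrite /flat ltNge x0. Qed.

Lemma flat_ge0 k x : 0 <= flat k x.
Proof.
case: (ltP 0 x) => x0; first exact: ltW (flat_gt0 k x0).
by rewrite flat_le0.
Qed.

(** For x > 0, exp(1/x) dominates its Taylor term of order k + 1, which beats x^-k by one power of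
    x. This linear bound is what gives the derivative at 0. *)
Lemma flat_le k x : `|flat k x| <= k.+1`!%:R * `|x|.
Proof.
rewrite ger0_norm ?flat_ge0 //.
case: (ltP 0 x) => x0; last by rewrite flat_le0 // mulr_ge0.
rewrite /flat x0 gtr0_norm // expRN.
have xi : 0 <= x^-1 by rewrite invr_ge0 ltW.
have H : x ^- k.+1 / k.+1`!%:R <= expR x^-1.
  apply: le_trans (expR_ge1Dxn k xi).
  by rewrite exprVn lerDr.
have f0 : 0 < (k.+1`!%:R : R) by rewrite ltr0n fact_gt0.
rewrite ler_pdivrMr ?expR_gt0 //.
have {1}-> : x ^- k = k.+1`!%:R * x * (x ^- k.+1 / k.+1`!%:R).
  rewrite exprS invfM; move: (x ^- k) (k.+1`!%:R : R) f0 => y c c0.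
  by field; rewrite !gt_eqF.
by rewrite ler_pM2l // mulr_gt0.
Qed.

(** For x > 0 this is the product rule. At 0 the difference quotient of [flat k] is [flat k.+1],
    which tends to 0 by [flat_le], and every term of the formula vanishes there. *)
Lemma is_derive_flat k x :
  is_derive x 1 (flat k) (flat k.+2 x - k%:R * flat k.+1 x).
Proof.
have oG : open [set y : R | 0 < y] by exact: open_gt.
have oL : open [set y : R | y < 0] by exact: open_lt.
case: (ltrgtP x 0) => x0.
- rewrite !flat_le0 ?(ltW x0) // mulr0 subr0.
  apply: near_eq_is_derive (is_derive_cst 0 x 1).
  near=> y; rewrite /= flat_le0 // ltW //.
  by near: y; exact: open_nbhs_nbhs.
- have xn : x != 0 by rewrite gt_eqF.
  pose v y : R := y^-1.
  have nF : {near x, (fun y => (v ^+ k) y * expR (- v y)) =1 flat k}.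
    near=> y; rewrite /flat ifT; last by near: y; exact: open_nbhs_nbhs.
    by rewrite /v fctE exprVn.
  apply: (near_eq_is_derive nF).
  have dv : is_derive x 1 v (- x ^- 2).
    apply: (is_derive_eq (is_deriveV xn (is_derive_id _ _))).
    by rewrite [_ *: _]mulr1.
  have de : is_derive x 1 (fun y => expR (- v y)) (expR (- v x) * x ^- 2).
    have := @is_derive1_comp _ expR (- v) x _ _ (is_derive_expR _) (is_deriveN dv).
    by move=> H; apply: (is_derive_eq H); rewrite opprK.
  apply: (is_derive_eq (is_deriveM (is_deriveX k dv) de)).
  rewrite /flat x0 /v !fctE /GRing.scale /=.
  case: k {nF} => [|k].
    by rewrite !expr0 mul0r mulr0n !(mul0r, mulr0, mul1r, addr0, subr0) mulrC.
  rewrite /= !exprVn !exprS !invfM -mulr_natl expr0 invr1 !mulr1.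
  by move: (expR (- x^-1)) => a; move: (x ^- k) (x^-1) => b c; ring.
- rewrite x0 !flat_le0 // mulr0 subr0.
  suff cv : (fun h : R => h^-1 *: (flat k (h *: 1 + 0) - flat k 0)) @ 0^' --> (0 : R).
    apply: DeriveDef; first by apply/cvg_ex; exists 0.
    exact: cvg_lim.
  have F0 : 0 < k.+2`!%:R :> R by rewrite ltr0n fact_gt0.
  apply/cvgrPdist_le => e e0; near=> h.
  have h0 : h != 0 by near: h; exact: nbhs_dnbhs_neq.
  have hE : h^-1 *: (flat k (h *: 1 + 0) - flat k 0) = flat k.+1 h.
    rewrite addr0 [h *: 1]mulr1 (@flat_le0 k 0) // subr0 /GRing.scale /= /flat.
    by case: ifP => _; rewrite ?mulr0 // mulrA exprS invfM.
  rewrite hE sub0r normrN; apply: le_trans (flat_le _ _) _.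
  rewrite -ler_pdivlMl //; near: h; apply: dnbhs0_le.
  by rewrite mulr_gt0 // invr_gt0.
Unshelve. all: by end_near. Qed.

(** The induction on k is uniform in j because differentiation raises j to j + 1 and j + 2. *)
Lemma Ck_flat {m : nat} k j (V : set 'rV[R]_m) (f : 'rV[R]_m -> R) : open V ->
  Ck k V f -> Ck k V (fun y => flat j (f y)).
Proof.
move=> oV; elim: k j => [|k IH] j Cf.
  apply: Ck_comp_continuous; first exact: Ck_continuous Cf.
  move=> y _; apply: differentiable_continuous; apply/derivable1_diffP.
  by have [] := is_derive_flat j (f y).
apply: (Ck_comp1 (s' := fun y => flat j.+2 y - j%:R * flat j.+1 y)) => //.
  by move=> y _; exact: is_derive_flat.
have Cf' := CkS Cf.
apply: (Ck_add oV (IH _ Cf')); apply: (Ck_opp oV); apply: (Ck_mul oV) (IH _ Cf').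
exact: Ck_cst.
Qed.

End FlatFunction.

(** * Calculus on the manifold *)

Section SmoothFunctions.
Context {R : realType} {m : nat} {M : topologicalType} (X : manifold R m M).
Implicit Types (p q r : M) (U W : set M) (f g : M -> R).

Local Notation dom p := (cdom (chart_at X p)).
Local Notation map p := (cmap (chart_at X p)).
Local Notation inv p := (cinv (chart_at X p)).
Local Notation img p U := (map p @` (dom p `&` U)).

Lemma chart_mapK p q : dom p q -> inv p (map p q) = q.
Proof. exact: cmapK. Qed.

(** Inside the open chart image, this set is the preimage of U under [cinv], which is continuous
    there. *)
Lemma open_img p U : open U -> open (img p U).
Proof.
move=> oU; rewrite openE => x [q [pq Uq] <-{x}].
have ximg : (map p @` dom p) (map p q) by exists q.
have cinvx := @cinv_cont _ _ _ (chart_at X p) _ (mem_set ximg).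
have N1 : nbhs (inv p (map p q)) U by rewrite chart_mapK //; exact: open_nbhs_nbhs.
have N2 : nbhs (map p q) (map p @` dom p).
  by apply: open_nbhs_nbhs; split => //; exact: cimg_open.
have H : nbhs (map p q) (map p @` dom p `&` inv p @^-1` U).
  exact: (filterI N2 (cinvx _ N1)).
rewrite /interior /=.
apply: (@filterS _ _ (nbhs_filter _) _ _ _ H) => y [[s ps <-]]; rewrite /= chart_mapK // => Us.
by exists s.
Qed.

Lemma img_mem p U q : dom p q -> U q -> img p U (map p q).
Proof. by move=> pq Uq; exists q. Qed.

Lemma transition_continuous p q U : U `<=` dom q -> {in img p U, continuous (map q \o inv p)}.
Proof.
move=> Uq x /set_mem [r [pr Ur] <-]; apply: continuous_comp.
  by apply: cinv_cont; apply: mem_set; exists r.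
by rewrite chart_mapK //; apply: cmap_cont; apply: mem_set; exact: Uq.
Qed.

(** One chart around each point is enough: any other chart differs from it by a smooth transition
    map, and [Ck_comp] transports C^k regularity along that map. *)
Lemma smooth_on_chart U f :
  (forall r, U r -> exists p W, [/\ open W, W r, dom p r & Cinfty (img p W) (f \o inv p)]) ->
  smooth_on X U f.
Proof.
move=> H q k; apply: Ck_local => _ [r [qr Ur] <-].
have [p [W [oW Wr pr CW]]] := H r Ur.
have oD : open (dom p `&` W) by apply: openI => //; exact: cdom_open.
exists (img q (dom p `&` W)); first by exists r.
have := @Ck_comp R m m k (img q (dom p `&` W)) (img p W) (f \o inv p) (map p \o inv q)
  (open_img oD) (open_img oW) _ _ _ (CW k).
move=> HC; apply: Ck_ext (HC _ _ _) => //; first exact: open_img.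
- by move=> _ [s [qs [ps Ws]] <-] /=; rewrite chart_mapK // chart_mapK.
- by move=> _ [s [qs [ps Ws]] <-] /=; rewrite chart_mapK //; exists s.
- by apply: transition_continuous => s [].
- move=> j l; apply: Ck_subset (chart_compat X q p j l).
  by move=> _ [s [qs [ps Ws]] <-]; exists s.
Qed.

Lemma smooth_on_subset U W f : U `<=` W -> smooth_on X W f -> smooth_on X U f.
Proof.
move=> UW Wf p k; apply: Ck_subset (Wf p k) => _ [s [ps Us] <-].
by exists s => //; split => //; exact: UW.
Qed.

Lemma smooth_on_local U f :
  (forall r, U r -> exists W, [/\ open W, W r & smooth_on X W f]) -> smooth_on X U f.
Proof.
move=> H; apply: smooth_on_chart => r /H [W [oW Wr fW]].
by exists r, W; split => //; exact: chart_atP.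
Qed.

Lemma smooth_on_ext U f g : open U -> (forall q, U q -> f q = g q) ->
  smooth_on X U f -> smooth_on X U g.
Proof.
move=> oU fg Uf p k; apply: Ck_ext (Uf p k); first exact: open_img.
by move=> _ [s [ps Us] <-] /=; rewrite chart_mapK // fg.
Qed.

Lemma smooth_on_cst U (a : R) : smooth_on X U (fun=> a).
Proof. by move=> p k; exact: Ck_cst. Qed.

Lemma smooth_on_add U f g : open U -> smooth_on X U f -> smooth_on X U g ->
  smooth_on X U (fun q => f q + g q).
Proof. by move=> oU Uf Ug p k; exact: (Ck_add (open_img oU) (Uf p k) (Ug p k)). Qed.

Lemma smooth_on_opp U f : open U -> smooth_on X U f -> smooth_on X U (fun q => - f q).
Proof. by move=> oU Uf p k; exact: (Ck_opp (open_img oU) (Uf p k)). Qed.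

Lemma smooth_on_mul U f g : open U -> smooth_on X U f -> smooth_on X U g ->
  smooth_on X U (fun q => f q * g q).
Proof. by move=> oU Uf Ug p k; exact: (Ck_mul (open_img oU) (Uf p k) (Ug p k)). Qed.

Lemma smooth_on_sum U (I : Type) (s : seq I) (F : I -> M -> R) : open U ->
  (forall i, smooth_on X U (F i)) -> smooth_on X U (fun q => \sum_(i <- s) F i q).
Proof.
move=> oU UF p k.
exact: (@Ck_sum _ _ _ _ _ s (fun i => F i \o inv p) (open_img oU) (fun i => UF i p k)).
Qed.

Lemma smooth_on_inv U f : open U -> (forall q, U q -> f q != 0) ->
  smooth_on X U f -> smooth_on X U (fun q => (f q)^-1).
Proof.
move=> oU f0 Uf p k; apply: (@Ck_inv _ _ _ _ (f \o inv p)); [exact: open_img| |exact: Uf].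
by move=> _ [s [ps Us] <-] /=; rewrite chart_mapK // f0.
Qed.

Lemma smooth_on_expR U f : open U -> smooth_on X U f -> smooth_on X U (fun q => expR (f q)).
Proof. by move=> oU Uf p k; exact: (Ck_expR (open_img oU) (Uf p k)). Qed.

Lemma smooth_on_sqrt U f : open U -> (forall q, U q -> 0 < f q) ->
  smooth_on X U f -> smooth_on X U (fun q => Num.sqrt (f q)).
Proof.
move=> oU f0 Uf p k; apply: (@Ck_sqrt _ _ _ _ (f \o inv p)); [exact: open_img| |exact: Uf].
by move=> _ [s [ps Us] <-] /=; rewrite chart_mapK // f0.
Qed.

Lemma smooth_on_flat j U f : open U -> smooth_on X U f -> smooth_on X U (fun q => flat j (f q)).
Proof. by move=> oU Uf p k; exact: (Ck_flat j (open_img oU) (Uf p k)). Qed.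

Lemma smooth_on_coord p k : smooth_on X (dom p) (fun q => map p q 0 k).
Proof. by move=> q; exact: chart_compat. Qed.

Lemma smooth_on_continuous U f : open U -> smooth_on X U f -> {in U, continuous f}.
Proof.
move=> oU Uf q /set_mem Uq.
have qq := chart_atP X q.
have c0 := Ck_continuous (Uf q 0%N) (mem_set (img_mem qq Uq)).
have c1 : {for q, continuous ((f \o inv q) \o map q)}.
  by apply: continuous_comp => //; apply: cmap_cont; exact: mem_set.
apply: near_continuous c1; near=> s; rewrite /= chart_mapK //.
by near: s; apply: open_nbhs_nbhs; split => //; exact: cdom_open.
Unshelve. all: by end_near. Qed.

(** The real counterpart of [chart_partial], whose real and imaginary parts are of this shape by
    conversion. *)
Definition rpartial p (i : 'I_m) f q : R := partial i (f \o inv p) (map p q).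

Section AtPoint.
Variables (p q : M) (U : set M).
Hypotheses (oU : open U) (Uq : U q) (pq : dom p q).

Let oV : open (img p U). Proof. exact: open_img. Qed.
Let Vx : img p U (map p q). Proof. exact: img_mem. Qed.

Lemma rpartial_ext i f g : (forall s, U s -> f s = g s) -> rpartial p i f q = rpartial p i g q.
Proof.
move=> fg; apply: (partial_ext i oV Vx) => _ [s [ps Us] <-] /=.
by rewrite chart_mapK // fg.
Qed.

Lemma rpartial_is_derive i f : smooth_on X U f ->
  is_derive (map p q) (delta_mx 0 i) (f \o inv p) (rpartial p i f q).
Proof. by move=> Uf; apply: partial_is_derive; exact: Ck_derivable (Uf p 1%N) Vx. Qed.

Lemma rpartial_cst i (a : R) : rpartial p i (fun=> a) q = 0.
Proof. exact: derive_cst. Qed.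

Lemma rpartial_add i f g : smooth_on X U f -> smooth_on X U g ->
  rpartial p i (fun s => f s + g s) q = rpartial p i f q + rpartial p i g q.
Proof.
move=> /(rpartial_is_derive i) Df /(rpartial_is_derive i) Dg.
by have [_ E] := is_deriveD Df Dg; rewrite [LHS]E.
Qed.

Lemma rpartial_opp i f : smooth_on X U f ->
  rpartial p i (fun s => - f s) q = - rpartial p i f q.
Proof.
move=> /(rpartial_is_derive i) Df.
by have [_ E] := is_deriveN Df; rewrite [LHS]E.
Qed.

Lemma rpartial_mul i f g : smooth_on X U f -> smooth_on X U g ->
  rpartial p i (fun s => f s * g s) q = rpartial p i f q * g q + f q * rpartial p i g q.
Proof.
move=> /(rpartial_is_derive i) Df /(rpartial_is_derive i) Dg.
have [_ E] := is_deriveM Df Dg; rewrite [LHS]E /= !chart_mapK //.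
by rewrite /GRing.scale /= addrC mulrC.
Qed.

Lemma rpartial_expR i f : smooth_on X U f ->
  rpartial p i (fun s => expR (f s)) q = expR (f q) * rpartial p i f q.
Proof.
move=> /(rpartial_is_derive i) Df; have [dE vE] := Df.
rewrite /rpartial /partial !derive_line.
set F := fun t : R => (f \o inv p) (t *: delta_mx 0 i + map p q).
have F0 : F 0 = f q by rewrite /F scale0r add0r /= chart_mapK.
have dF : derivable F 0 1 by exact: (iffLR (derivable1P _ _ _)).
have [_ E] := is_derive1_comp (is_derive_expR (F 0)) (derivableP dF).
by rewrite -F0 -E.
Qed.

Lemma rpartial_comm i j f : smooth_on X U f ->
  rpartial p i (rpartial p j f) q = rpartial p j (rpartial p i f) q.
Proof.
move=> Uf; have E k l : rpartial p k (rpartial p l f) q =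
    partial k (partial l (f \o inv p)) (map p q).
  apply: (partial_ext k oV Vx) => _ [s [ps Us] <-] /=.
  by rewrite /rpartial chart_mapK.
by rewrite !E; exact: (partial_comm i j oV Vx (Uf p 2%N)).
Qed.

Lemma rpartial_coord i j : rpartial p i (fun s => map p s 0 j) q = (i == j)%:R.
Proof.
have oD : open (img p (dom p)) by apply: open_img; exact: cdom_open.
have Dx : img p (dom p) (map p q) by exact: img_mem.
have [_ <-] := partial_coord i j (map p q).
apply: (partial_ext i oD Dx) => _ [s [ps Us] <-] /=.
by rewrite chart_mapK.
Qed.

Lemma rpartial_chain p' i f : dom p' q -> smooth_on X U f ->
  rpartial p' i f q = \sum_j rpartial p' i (fun s => map p s 0 j) q * rpartial p j f q.
Proof.
move=> p'q Uf.
have oD : open (dom p `&` U) by apply: openI => //; exact: cdom_open.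
have oV' := @open_img p' _ oD.
have V'x : img p' (dom p `&` U) (map p' q) by exact: img_mem.
pose phi := map p \o inv p'.
have phix : phi (map p' q) = map p q by rewrite /phi /= chart_mapK.
rewrite {1}/rpartial (@partial_ext _ _ _ _ ((f \o inv p) \o phi) i _ oV' V'x); last first.
  by move=> _ [s [p's [ps Us]] <-] /=; rewrite /phi /= chart_mapK // chart_mapK.
have [|j|_ E] := @is_derive_comp R m m (f \o inv p) phi (map p' q) (delta_mx 0 i).
- rewrite phix; apply: (C1_differentiable oV Vx) => j.
    by move=> y Vy; exact: Ck_derivable (Uf p 1%N) Vy.
  exact: Ck_continuous (Ck_partial j (Uf p 1%N)).
- apply: (Ck_derivable (chart_compat X p' p j 1%N)).
  by exists q.
by rewrite [LHS]E phix.
Qed.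

End AtPoint.

Lemma smooth_on_rpartial p i U f : open U -> smooth_on X U f ->
  smooth_on X (U `&` dom p) (rpartial p i f).
Proof.
move=> oU Uf; apply: smooth_on_chart => r [Ur pr].
exists p, U; split => // k.
apply: Ck_ext (Ck_partial i (Uf p k.+1)); first exact: open_img.
by move=> _ [s [ps Us] <-] /=; rewrite /rpartial chart_mapK.
Qed.

End SmoothFunctions.

(** * Complex-valued functions through their real and imaginary parts *)

Section ComplexParts.
Context {R : realType}.
Implicit Types (x y : R[i]) (a : R).

Lemma ReD x y : complex.Re (x + y) = complex.Re x + complex.Re y.
Proof. by case: x; case: y. Qed.
Lemma ImD x y : complex.Im (x + y) = complex.Im x + complex.Im y.
Proof. by case: x; case: y. Qed.
Lemma ReN x : complex.Re (- x) = - complex.Re x.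
Proof. by case: x. Qed.
Lemma ImN x : complex.Im (- x) = - complex.Im x.
Proof. by case: x. Qed.
Lemma ReM x y : complex.Re (x * y) = complex.Re x * complex.Re y - complex.Im x * complex.Im y.
Proof. by case: x; case: y. Qed.
Lemma ImM x y : complex.Im (x * y) = complex.Re x * complex.Im y + complex.Im x * complex.Re y.
Proof. by case: x => a b; case: y => c d; rewrite /= addrC. Qed.
Lemma Re_conj x : complex.Re (Num.conj x) = complex.Re x.
Proof. by case: x. Qed.
Lemma Im_conj x : complex.Im (Num.conj x) = - complex.Im x.
Proof. by case: x. Qed.
Lemma ReV x : complex.Re x^-1 = complex.Re x * (complex.Re x ^+ 2 + complex.Im x ^+ 2)^-1.
Proof. by case: x. Qed.
Lemma ImV x : complex.Im x^-1 = - complex.Im x * (complex.Re x ^+ 2 + complex.Im x ^+ 2)^-1.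
Proof. by case: x => a b; rewrite /= mulNr. Qed.
Lemma complexP x y : complex.Re x = complex.Re y -> complex.Im x = complex.Im y -> x = y.
Proof. by case: x; case: y => a b c d /= -> ->. Qed.
Lemma conj_real_complex a : Num.conj (a%:C) = a%:C :> R[i].
Proof. by apply: complexP => //=; rewrite oppr0. Qed.

End ComplexParts.

Section ComplexSmooth.
Context {R : realType} {m : nat} {M : topologicalType} (X : manifold R m M).
Local Notation C := R[i].
Implicit Types (p q r : M) (U W : set M) (f g : M -> C).

Local Notation dom p := (cdom (chart_at X p)).
Local Notation cp p := (chart_partial (chart_at X p)).

Lemma csmooth_on_subset U W f : U `<=` W -> csmooth_on X W f -> csmooth_on X U f.
Proof. by move=> UW [Wr Wi]; split; exact: smooth_on_subset UW _. Qed.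

Lemma csmooth_on_local U f :
  (forall r, U r -> exists W, [/\ open W, W r & csmooth_on X W f]) -> csmooth_on X U f.
Proof.
move=> H; split; apply: smooth_on_local => r /H [W [oW Wr [Wre Wim]]];
by exists W.
Qed.

Lemma csmooth_on_ext U f g : open U -> (forall q, U q -> f q = g q) ->
  csmooth_on X U f -> csmooth_on X U g.
Proof.
move=> oU fg [Ur Ui]; split.
  by apply: smooth_on_ext Ur => // q /fg ->.
by apply: smooth_on_ext Ui => // q /fg ->.
Qed.

Lemma csmooth_on_cst U (a : C) : csmooth_on X U (fun=> a).
Proof. by split; exact: smooth_on_cst. Qed.

Lemma csmooth_on_cfun U (f : M -> R) : smooth_on X U f -> csmooth_on X U (cfun f).
Proof. by move=> Uf; split=> //; exact: smooth_on_cst. Qed.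

Lemma csmooth_on_add U f g : open U -> csmooth_on X U f -> csmooth_on X U g ->
  csmooth_on X U (fun q => f q + g q).
Proof.
move=> oU [fr fi] [gr gi]; split.
  by apply: smooth_on_ext (smooth_on_add oU fr gr) => // q _; rewrite ReD.
by apply: smooth_on_ext (smooth_on_add oU fi gi) => // q _; rewrite ImD.
Qed.

Lemma csmooth_on_opp U f : open U -> csmooth_on X U f -> csmooth_on X U (fun q => - f q).
Proof.
move=> oU [fr fi]; split.
  by apply: smooth_on_ext (smooth_on_opp oU fr) => // q _; rewrite ReN.
by apply: smooth_on_ext (smooth_on_opp oU fi) => // q _; rewrite ImN.
Qed.

Lemma csmooth_on_sub U f g : open U -> csmooth_on X U f -> csmooth_on X U g ->
  csmooth_on X U (fun q => f q - g q).
Proof. by move=> oU Uf Ug; exact: (csmooth_on_add oU Uf (csmooth_on_opp oU Ug)). Qed.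

Lemma csmooth_on_mul U f g : open U -> csmooth_on X U f -> csmooth_on X U g ->
  csmooth_on X U (fun q => f q * g q).
Proof.
move=> oU [fr fi] [gr gi]; split.
  apply: smooth_on_ext (smooth_on_add oU (smooth_on_mul oU fr gr)
    (smooth_on_opp oU (smooth_on_mul oU fi gi))) => // q _.
  by rewrite ReM.
apply: smooth_on_ext (smooth_on_add oU (smooth_on_mul oU fr gi)
    (smooth_on_mul oU fi gr)) => // q _.
by rewrite ImM.
Qed.

Lemma csmooth_on_conj U f : open U -> csmooth_on X U f ->
  csmooth_on X U (fun q => Num.conj (f q)).
Proof.
move=> oU [fr fi]; split.
  by apply: smooth_on_ext fr => // q _; rewrite Re_conj.
by apply: smooth_on_ext (smooth_on_opp oU fi) => // q _; rewrite Im_conj.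
Qed.

Lemma csmooth_on_inv U f : open U -> (forall q, U q -> f q != 0) ->
  csmooth_on X U f -> csmooth_on X U (fun q => (f q)^-1).
Proof.
move=> oU f0 [fr fi].
have N : smooth_on X U (fun q => (complex.Re (f q) ^+ 2 + complex.Im (f q) ^+ 2)^-1).
  apply: smooth_on_inv => //.
    move=> q /f0; apply: contraNneq => /eqP.
    rewrite paddr_eq0 ?sqr_ge0 // !expf_eq0 /= => /andP[/eqP r0 /eqP i0].
    exact/eqP/complexP.
  by apply: smooth_on_ext (smooth_on_add oU (smooth_on_mul oU fr fr) (smooth_on_mul oU fi fi)).
split.
  by apply: smooth_on_ext (smooth_on_mul oU fr N) => // q _; rewrite ReV.
by apply: smooth_on_ext (smooth_on_mul oU (smooth_on_opp oU fi) N) => // q _; rewrite ImV.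
Qed.

Lemma csmooth_on_sum U (I : Type) (s : seq I) (F : I -> M -> C) : open U ->
  (forall i, csmooth_on X U (F i)) -> csmooth_on X U (fun q => \sum_(i <- s) F i q).
Proof.
move=> oU UF; elim: s => [|i s IH].
  by apply: csmooth_on_ext (csmooth_on_cst U 0) => // q _; rewrite big_nil.
by apply: csmooth_on_ext (csmooth_on_add oU (UF i) IH) => // q _; rewrite big_cons.
Qed.

Lemma csmooth_on_prod U (I : Type) (s : seq I) (F : I -> M -> C) : open U ->
  (forall i, csmooth_on X U (F i)) -> csmooth_on X U (fun q => \prod_(i <- s) F i q).
Proof.
move=> oU UF; elim: s => [|i s IH].
  by apply: csmooth_on_ext (csmooth_on_cst U 1) => // q _; rewrite big_nil.
by apply: csmooth_on_ext (csmooth_on_mul oU (UF i) IH) => // q _; rewrite big_cons.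
Qed.

Lemma csmooth_on_det U k (A : M -> 'M[C]_k) : open U ->
  (forall i j, csmooth_on X U (fun q => A q i j)) -> csmooth_on X U (fun q => \det (A q)).
Proof.
move=> oU UA; apply: csmooth_on_sum => // s.
apply: (csmooth_on_mul oU (csmooth_on_cst _ _)).
exact: (csmooth_on_prod _ oU).
Qed.

(** By Cramer's rule the entries are cofactors divided by the determinant. This is the source of the
    smoothness of the regularized solution. *)
Lemma csmooth_on_invmx U k (A : M -> 'M[C]_k) i j : open U ->
  (forall q, U q -> A q \in unitmx) ->
  (forall i j, csmooth_on X U (fun q => A q i j)) -> csmooth_on X U (fun q => invmx (A q) i j).
Proof.
move=> oU A_unit UA.
apply: (@csmooth_on_ext _ (fun q => (\det (A q))^-1 * ((-1) ^+ (j + i) *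
    \det (row' j (col' i (A q)))))) => //.
  by move=> q /A_unit Aq; rewrite /invmx Aq !mxE.
have dA : forall q, U q -> \det (A q) != 0.
  by move=> q /A_unit; rewrite unitmxE unitfE.
apply: (csmooth_on_mul oU (csmooth_on_inv oU dA (csmooth_on_det oU UA))).
apply: (csmooth_on_mul oU (csmooth_on_cst _ _)).
apply: (csmooth_on_det oU) => k1 k2.
by apply: csmooth_on_ext (UA (lift j k1) (lift i k2)) => // q _; rewrite !mxE.
Qed.

Lemma csmooth_on_coord p k : csmooth_on X (dom p) (Defs.coord (chart_at X p) k).
Proof. by apply: csmooth_on_cfun; exact: smooth_on_coord. Qed.

Lemma csmooth_on_chart_partial p i U f : open U -> csmooth_on X U f ->
  csmooth_on X (U `&` dom p) (cp p i f).
Proof.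
move=> oU [fr fi]; split.
  exact: (smooth_on_rpartial p i oU fr).
exact: (smooth_on_rpartial p i oU fi).
Qed.

Lemma Re_chart_partial p i f q :
  complex.Re (cp p i f q) = rpartial X p i (fun s => complex.Re (f s)) q.
Proof. by []. Qed.

Lemma Im_chart_partial p i f q :
  complex.Im (cp p i f q) = rpartial X p i (fun s => complex.Im (f s)) q.
Proof. by []. Qed.

Section AtPoint.
Variables (p q : M) (U : set M).
Hypotheses (oU : open U) (Uq : U q) (pq : dom p q).

Lemma chart_partial_ext i f g : (forall s, U s -> f s = g s) -> cp p i f q = cp p i g q.
Proof.
move=> fg; apply: complexP.
  by rewrite !Re_chart_partial; apply: (rpartial_ext oU Uq pq i) => s /fg ->.
by rewrite !Im_chart_partial; apply: (rpartial_ext oU Uq pq i) => s /fg ->.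
Qed.

Lemma chart_partial_cst i (a : C) : cp p i (fun=> a) q = 0.
Proof. by apply: complexP; exact: derive_cst. Qed.

Lemma chart_partial_add i f g : csmooth_on X U f -> csmooth_on X U g ->
  cp p i (fun s => f s + g s) q = cp p i f q + cp p i g q.
Proof.
move=> [fr fi] [gr gi]; apply: complexP.
  rewrite ReD !Re_chart_partial -[RHS](rpartial_add Uq pq i fr gr).
  by apply: (rpartial_ext oU Uq pq i) => s _; rewrite ReD.
rewrite ImD !Im_chart_partial -[RHS](rpartial_add Uq pq i fi gi).
by apply: (rpartial_ext oU Uq pq i) => s _; rewrite ImD.
Qed.

Lemma chart_partial_mul i f g : csmooth_on X U f -> csmooth_on X U g ->
  cp p i (fun s => f s * g s) q = cp p i f q * g q + f q * cp p i g q.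
Proof.
move=> [fr fi] [gr gi].
have rr := smooth_on_mul oU fr gr; have ii := smooth_on_mul oU fi gi.
have ri := smooth_on_mul oU fr gi; have ir := smooth_on_mul oU fi gr.
apply: complexP.
  rewrite ReD !ReM !Re_chart_partial !Im_chart_partial.
  transitivity (rpartial X p i (fun s => complex.Re (f s) * complex.Re (g s) +
     - (complex.Im (f s) * complex.Im (g s))) q).
    by apply: (rpartial_ext oU Uq pq i) => s _; rewrite ReM.
  rewrite (rpartial_add Uq pq i rr (smooth_on_opp oU ii)) (rpartial_opp Uq pq i ii).
  rewrite (rpartial_mul Uq pq i fr gr) (rpartial_mul Uq pq i fi gi).
  by ring.
rewrite ImD !ImM !Re_chart_partial !Im_chart_partial.
transitivity (rpartial X p i (fun s => complex.Re (f s) * complex.Im (g s) +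
     complex.Im (f s) * complex.Re (g s)) q).
  by apply: (rpartial_ext oU Uq pq i) => s _; rewrite ImM.
rewrite (rpartial_add Uq pq i ri ir).
rewrite (rpartial_mul Uq pq i fr gi) (rpartial_mul Uq pq i fi gr).
by ring.
Qed.

Lemma chart_partial_conj i f : csmooth_on X U f ->
  cp p i (fun s => Num.conj (f s)) q = Num.conj (cp p i f q).
Proof.
move=> [fr fi]; apply: complexP.
  rewrite Re_conj !Re_chart_partial; apply: (rpartial_ext oU Uq pq i) => s _; exact: Re_conj.
rewrite Im_conj !Im_chart_partial -[RHS](rpartial_opp Uq pq i fi).
apply: (rpartial_ext oU Uq pq i) => s _; exact: Im_conj.
Qed.

Lemma chart_partial_comm i j f : csmooth_on X U f ->
  cp p i (cp p j f) q = cp p j (cp p i f) q.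
Proof.
move=> [fr fi]; apply: complexP.
  exact: (rpartial_comm oU Uq pq i j fr).
exact: (rpartial_comm oU Uq pq i j fi).
Qed.

Lemma chart_partial_coord i j : cp p i (Defs.coord (chart_at X p) j) q = (i == j)%:R.
Proof.
apply: complexP.
  by rewrite [LHS](rpartial_coord pq i j); case: (i == j).
by rewrite [LHS](rpartial_cst); case: (i == j).
Qed.

Lemma chart_partial_cfun_expR i (f : M -> R) : smooth_on X U f ->
  cp p i (cfun (expR \o f)) q = (expR (f q))%:C * cp p i (cfun f) q.
Proof.
move=> Uf; have I0 : rpartial X p i (fun=> 0 : R) q = 0 by exact: rpartial_cst.
apply: complexP.
  rewrite ReM /= mul0r subr0; exact: (rpartial_expR Uq pq i Uf).
by rewrite ImM /= mul0r addr0 [LHS]I0 [X in _ * X]I0 mulr0.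
Qed.

Lemma chart_partial_chain p' i f : dom p' q -> csmooth_on X U f ->
  cp p' i f q = \sum_j cp p' i (Defs.coord (chart_at X p) j) q * cp p j f q.
Proof.
move=> p'q [fr fi].
have I0 : rpartial X p' i (fun=> 0 : R) q = 0 by exact: rpartial_cst.
have ReS (F : 'I_m -> C) : complex.Re (\sum_j F j) = \sum_j complex.Re (F j).
  by apply: (big_morph _ (@ReD R)).
have ImS (F : 'I_m -> C) : complex.Im (\sum_j F j) = \sum_j complex.Im (F j).
  by apply: (big_morph _ (@ImD R)).
apply: complexP.
  rewrite ReS [LHS](rpartial_chain oU Uq pq i p'q fr); apply: eq_bigr => j _.
  by rewrite ReM /= [X in _ - X * _]I0 mul0r subr0.
rewrite ImS [LHS](rpartial_chain oU Uq pq i p'q fi); apply: eq_bigr => j _.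
by rewrite ImM /= [X in _ + X * _]I0 mul0r addr0.
Qed.

End AtPoint.
End ComplexSmooth.

(** * Vector fields, brackets and Cartan's formulas *)

Section VectorFields.
Context {R : realType} {m : nat} {M : topologicalType} (X : manifold R m M).
Local Notation C := R[i].
Implicit Types (p q r : M) (U W : set M) (f g : M -> C) (v w : tangent R m).
Implicit Types (Y Z : vfield R m M) (om : form1 R m M).

Local Notation dom p := (cdom (chart_at X p)).
Local Notation cp p := (chart_partial (chart_at X p)).
Local Notation xc p := (Defs.coord (chart_at X p)).
Local Notation dx p := (coord_field X (chart_at X p)).

Lemma tact_ext q U v f g : open U -> U q -> (forall s, U s -> f s = g s) ->
  tact X q v f = tact X q v g.
Proof.
move=> oU Uq fg; apply: eq_bigr => i _.
by rewrite (chart_partial_ext oU Uq (chart_atP X q) i fg).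
Qed.

Lemma tact_cst q v (a : C) : tact X q v (fun=> a) = 0.
Proof. by apply: big1 => i _; rewrite chart_partial_cst mulr0. Qed.

Lemma tact_add q U v f g : open U -> U q -> csmooth_on X U f -> csmooth_on X U g ->
  tact X q v (fun s => f s + g s) = tact X q v f + tact X q v g.
Proof.
move=> oU Uq Uf Ug; rewrite /tact -big_split /=; apply: eq_bigr => i _.
by rewrite (chart_partial_add oU Uq (chart_atP X q) i Uf Ug) mulrDr.
Qed.

Lemma tact_mul q U v f g : open U -> U q -> csmooth_on X U f -> csmooth_on X U g ->
  tact X q v (fun s => f s * g s) = tact X q v f * g q + f q * tact X q v g.
Proof.
move=> oU Uq Uf Ug; rewrite /tact mulr_suml mulr_sumr -big_split /=.
apply: eq_bigr => i _.
by rewrite (chart_partial_mul oU Uq (chart_atP X q) i Uf Ug); ring.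
Qed.

Lemma tact_sum q U v (I : Type) (s : seq I) (F : I -> M -> C) : open U -> U q ->
  (forall i, csmooth_on X U (F i)) ->
  tact X q v (fun t => \sum_(i <- s) F i t) = \sum_(i <- s) tact X q v (F i).
Proof.
move=> oU Uq UF; elim: s => [|i s IH].
  rewrite big_nil -[RHS](tact_cst q v 0); apply: (tact_ext v oU Uq) => t _.
  by rewrite big_nil.
rewrite big_cons -IH -(tact_add v oU Uq (UF i) (csmooth_on_sum s oU UF)).
by apply: (tact_ext v oU Uq) => t _; rewrite big_cons.
Qed.

Lemma tact_conj q U v f : open U -> U q -> csmooth_on X U f ->
  tact X q (conjv v) (fun s => Num.conj (f s)) = Num.conj (tact X q v f).
Proof.
move=> oU Uq Uf; rewrite /tact rmorph_sum; apply: eq_bigr => i _.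
by rewrite (chart_partial_conj oU Uq (chart_atP X q) i Uf) mxE rmorphM.
Qed.

Lemma tactDv q v w f : tact X q (v + w) f = tact X q v f + tact X q w f.
Proof. by rewrite /tact -big_split; apply: eq_bigr => i _; rewrite mxE mulrDl. Qed.

Lemma tactZv q (a : C) v f : tact X q (a *: v) f = a * tact X q v f.
Proof. by rewrite /tact mulr_sumr; apply: eq_bigr => i _; rewrite mxE mulrA. Qed.

Lemma tact0v q f : tact X q 0 f = 0.
Proof. by apply: big1 => i _; rewrite mxE mul0r. Qed.

Lemma tact_sumv q (I : Type) (s : seq I) (F : I -> tangent R m) f :
  tact X q (\sum_(i <- s) F i) f = \sum_(i <- s) tact X q (F i) f.
Proof.
elim: s => [|i s IH]; last by rewrite !big_cons tactDv IH.
by rewrite !big_nil tact0v.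
Qed.

(** [tact] at q uses the preferred chart of q, which varies with q in no controlled way. Rewriting
    it in a fixed chart p gives an expression that can be differentiated in q. *)
Lemma tact_chart p q U v f : open U -> U q -> dom p q -> csmooth_on X U f ->
  tact X q v f = \sum_j tact X q v (xc p j) * cp p j f q.
Proof.
move=> oU Uq pq Uf; rewrite /tact.
under eq_bigr => i _ do
  rewrite (chart_partial_chain oU Uq pq i (chart_atP X q) Uf) mulr_sumr.
rewrite exchange_big /=; apply: eq_bigr => j _; rewrite mulr_suml.
by apply: eq_bigr => i _; rewrite mulrA.
Qed.

Lemma tact_coord q v k : tact X q v (xc q k) = v 0 k.
Proof.
rewrite /tact (bigD1 k) //= big1 => [|i ik].
  by rewrite (chart_partial_coord (chart_atP X q)) eqxx mulr1 addr0.
by rewrite (chart_partial_coord (chart_atP X q)) (negPf ik) mulr0.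
Qed.

Lemma tact_coord_field p q U i f : open U -> U q -> dom p q -> csmooth_on X U f ->
  tact X q (dx p i q) f = cp p i f q.
Proof.
move=> oU Uq pq Uf; rewrite (chart_partial_chain oU Uq (chart_atP X q) i pq Uf).
by apply: eq_bigr => j _; rewrite mxE.
Qed.

Lemma vector_coord p q v : dom p q -> v = \sum_j tact X q v (xc p j) *: dx p j q.
Proof.
move=> pq; apply/rowP => k; rewrite summxE -[LHS](tact_coord q).
have oD := cdom_open (chart_at X q).
rewrite (tact_chart v oD (chart_atP X q) pq (csmooth_on_coord X q k)).
by apply: eq_bigr => j _; rewrite !mxE.
Qed.

Lemma coord_field_self p i : dx p i p = delta_mx 0 i.
Proof.
by apply/rowP => k; rewrite !mxE (chart_partial_coord (chart_atP X p)) eqxx /= eq_sym.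
Qed.

Lemma smooth_act U Y f : open U -> smooth_vf X U Y -> csmooth_on X U f ->
  csmooth_on X U (act X Y f).
Proof.
move=> oU UY Uf; apply: csmooth_on_local => r Ur.
have oW : open (U `&` dom r) by apply: openI => //; exact: cdom_open.
exists (U `&` dom r); split=> //; first by split=> //; exact: chart_atP.
have H : csmooth_on X (U `&` dom r) (fun q => \sum_j act X Y (xc r j) q * cp r j f q).
  apply: csmooth_on_sum => // j; apply: (csmooth_on_mul oW (UY r j)).
  exact: csmooth_on_chart_partial.
apply: csmooth_on_ext H => // q [Uq rq].
by rewrite /act (tact_chart _ oU Uq rq Uf).
Qed.

Lemma smooth_vf_subset U W Y : U `<=` W -> smooth_vf X W Y -> smooth_vf X U Y.
Proof.
move=> UW WY q k; apply: csmooth_on_subset (WY q k) => s [Us qs].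
by split=> //; exact: UW.
Qed.

Lemma smooth_vf_local U Y :
  (forall r, U r -> exists W, [/\ open W, W r & smooth_vf X W Y]) -> smooth_vf X U Y.
Proof.
move=> H q k; apply: csmooth_on_local => r [/H [W [oW Wr WY]] qr].
exists (W `&` dom q); split=> //.
by apply: openI => //; exact: cdom_open.
Qed.

Lemma smooth_vf_ext U Y Z : open U -> (forall q, U q -> Y q = Z q) ->
  smooth_vf X U Y -> smooth_vf X U Z.
Proof.
move=> oU YZ UY q k; apply: csmooth_on_ext (UY q k).
  by apply: openI => //; exact: cdom_open.
by move=> s [/YZ Us qs]; rewrite /act Us.
Qed.

Lemma smooth_vf_add U Y Z : open U -> smooth_vf X U Y -> smooth_vf X U Z ->
  smooth_vf X U (fun q => Y q + Z q).
Proof.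
move=> oU UY UZ q k.
have oW : open (U `&` dom q) by apply: openI => //; exact: cdom_open.
apply: csmooth_on_ext (csmooth_on_add oW (UY q k) (UZ q k)) => // s _.
by rewrite /act tactDv.
Qed.

Lemma smooth_vf_scale U (a : M -> C) Y : open U -> csmooth_on X U a -> smooth_vf X U Y ->
  smooth_vf X U (fun q => a q *: Y q).
Proof.
move=> oU Ua UY q k.
have oW : open (U `&` dom q) by apply: openI => //; exact: cdom_open.
have Wa : csmooth_on X (U `&` dom q) a by apply: csmooth_on_subset Ua => s [].
apply: csmooth_on_ext (csmooth_on_mul oW Wa (UY q k)) => // s _.
by rewrite /act tactZv.
Qed.

Lemma smooth_vf_opp U Y : open U -> smooth_vf X U Y -> smooth_vf X U (fun q => - Y q).
Proof.
move=> oU UY; apply: smooth_vf_ext (smooth_vf_scale oU (csmooth_on_cst X U (- 1)) UY) => //.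
by move=> q _; rewrite scaleN1r.
Qed.

Lemma smooth_vf_sum U (I : Type) (s : seq I) (F : I -> vfield R m M) : open U ->
  (forall i, smooth_vf X U (F i)) -> smooth_vf X U (fun q => \sum_(i <- s) F i q).
Proof.
move=> oU UF; elim: s => [|i s IH].
  move=> q k; apply: csmooth_on_ext (csmooth_on_cst X _ 0).
    by apply: openI => //; exact: cdom_open.
  by move=> t _; rewrite /act big_nil tact0v.
by apply: smooth_vf_ext (smooth_vf_add oU (UF i) IH) => // q _; rewrite big_cons.
Qed.

Lemma smooth_vf_conj U Y : open U -> smooth_vf X U Y -> smooth_vf X U (conjf Y).
Proof.
move=> oU UY q k.
have oW : open (U `&` dom q) by apply: openI => //; exact: cdom_open.
apply: csmooth_on_ext (csmooth_on_conj oW (UY q k)) => // s [Us qs].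
rewrite /act /conjf -(tact_conj (Y s) (cdom_open _) qs (csmooth_on_coord X q k)).
by apply: (tact_ext _ oU Us) => t _; rewrite /Defs.coord conj_real_complex.
Qed.

Lemma smooth_coord_field p i : smooth_vf X (dom p) (dx p i).
Proof.
have oD := cdom_open (chart_at X p).
move=> q k; have oW : open (dom p `&` dom q) by apply: openI => //; exact: cdom_open.
have := csmooth_on_chart_partial p i (cdom_open (chart_at X q)) (csmooth_on_coord X q k).
rewrite setIC; apply: csmooth_on_ext => // s [ps qs].
by rewrite /act (tact_coord_field i (cdom_open _) qs ps (csmooth_on_coord X q k)).
Qed.

(** The bracket is defined by its action on coordinates. For general f, expanding both iterated
    derivatives in the chart at p leaves second-order terms, which cancel by symmetry of second
    derivatives. *)
Lemma bracket_act U Y Z f p : open U -> U p -> smooth_vf X U Y -> smooth_vf X U Z ->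
  csmooth_on X U f ->
  tact X p (bracket X Y Z p) f = act X Y (act X Z f) p - act X Z (act X Y f) p.
Proof.
move=> oU Up UY UZ Uf; have pp := chart_atP X p.
have oW : open (U `&` dom p) by apply: openI => //; exact: cdom_open.
have Wp : (U `&` dom p) p by [].
pose D j := cp p j f.
have WD j : csmooth_on X (U `&` dom p) (D j) by exact: csmooth_on_chart_partial.
have expand (Y1 Z1 : vfield R m M) : smooth_vf X U Y1 -> smooth_vf X U Z1 ->
    act X Y1 (act X Z1 f) p = \sum_j act X Y1 (act X Z1 (xc p j)) p * D j p +
      \sum_j \sum_i Z1 p 0 j * Y1 p 0 i * cp p i (D j) p.
  move=> UY1 UZ1; rewrite {1}/act.
  rewrite (@tact_ext _ _ _ _ (fun q => \sum_j act X Z1 (xc p j) q * D j q) oW Wp); last first.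
    by move=> s [Us ps]; rewrite /act (tact_chart _ oU Us ps Uf).
  rewrite (tact_sum _ _ oW Wp) => [|j]; last exact: (csmooth_on_mul oW (UZ1 p j) (WD j)).
  rewrite -big_split /=; apply: eq_bigr => j _.
  rewrite (tact_mul _ oW Wp (UZ1 p j) (WD j)) {2}/act tact_coord; congr (_ + _).
  by rewrite /tact mulr_sumr; apply: eq_bigr => i _; rewrite mulrA.
rewrite (expand _ _ UY UZ) (expand _ _ UZ UY).
have -> : \sum_j \sum_i Z p 0 j * Y p 0 i * cp p i (D j) p =
    \sum_j \sum_i Y p 0 j * Z p 0 i * cp p i (D j) p.
  rewrite exchange_big /=; apply: eq_bigr => j _; apply: eq_bigr => i _.
  by rewrite /D (chart_partial_comm oU Up pp i j Uf); ring.
rewrite [in RHS]opprD [RHS]addrACA subrr addr0 -sumrB /tact.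
by apply: eq_bigr => j _; rewrite mxE mulrBl.
Qed.

Lemma smooth_bracket U Y Z : open U -> smooth_vf X U Y -> smooth_vf X U Z ->
  smooth_vf X U (bracket X Y Z).
Proof.
move=> oU UY UZ q k.
have oW : open (U `&` dom q) by apply: openI => //; exact: cdom_open.
have Wx : csmooth_on X (U `&` dom q) (xc q k).
  by apply: csmooth_on_subset (csmooth_on_coord X q k) => s [].
have WY : smooth_vf X (U `&` dom q) Y by apply: smooth_vf_subset UY => s [].
have WZ : smooth_vf X (U `&` dom q) Z by apply: smooth_vf_subset UZ => s [].
have H := csmooth_on_sub oW (smooth_act oW WY (smooth_act oW WZ Wx))
                             (smooth_act oW WZ (smooth_act oW WY Wx)).
apply: csmooth_on_ext H => // s Ws.
by rewrite [RHS](bracket_act oW Ws WY WZ Wx).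
Qed.

Lemma pairDv (a : cotangent R m) v w : Defs.pair a (v + w) = Defs.pair a v + Defs.pair a w.
Proof. by rewrite /Defs.pair mulmxDl mxE. Qed.

Lemma pairZv (a : cotangent R m) (c : C) v : Defs.pair a (c *: v) = c * Defs.pair a v.
Proof. by rewrite /Defs.pair -scalemxAl mxE. Qed.

Lemma pairNv (a : cotangent R m) v : Defs.pair a (- v) = - Defs.pair a v.
Proof. by rewrite -scaleN1r pairZv mulN1r. Qed.

Lemma pair_sumv (a : cotangent R m) (I : Type) (s : seq I) (F : I -> tangent R m) :
  Defs.pair a (\sum_(i <- s) F i) = \sum_(i <- s) Defs.pair a (F i).
Proof.
elim: s => [|i s IH]; last by rewrite !big_cons pairDv IH.
by rewrite !big_nil /Defs.pair mul0mx mxE.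
Qed.

(* The matrix of the exterior derivative of [om] at [p], in [chart_at X p]. *)
Definition dform om p : 'M[C]_m :=
  \matrix_(i, j) (cp p i (fun q => Defs.pair (om q) (dx p j q)) p -
                  cp p j (fun q => Defs.pair (om q) (dx p i q)) p).

(** Cartan's formula d om(Y, Z) = Y om(Z) - Z om(Y) - om([Y, Z]), solved for the bracket. If om(Y)
    and om(Z) are constant near p, only the values of Y and Z at p matter. *)
Lemma bracket_pair U om Y Z p : open U -> U p -> smooth_form X om ->
  smooth_vf X U Y -> smooth_vf X U Z ->
  Defs.pair (om p) (bracket X Y Z p) =
  act X Y (fun q => Defs.pair (om q) (Z q)) p -
  act X Z (fun q => Defs.pair (om q) (Y q)) p - (Y p *m dform om p *m (Z p)^T) 0 0.
Proof.
move=> oU Up om_s UY UZ; have pp := chart_atP X p.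
have oW : open (U `&` dom p) by apply: openI => //; exact: cdom_open.
have Wp : (U `&` dom p) p by [].
pose c j q := Defs.pair (om q) (dx p j q).
have Wc j : csmooth_on X (U `&` dom p) (c j).
  apply: csmooth_on_subset (om_s _ _ (cdom_open _) (smooth_coord_field p j)).
  by move=> s [].
have expand (Y1 Z1 : vfield R m M) : smooth_vf X U Y1 -> smooth_vf X U Z1 ->
    act X Y1 (fun q => Defs.pair (om q) (Z1 q)) p =
      \sum_j act X Y1 (act X Z1 (xc p j)) p * c j p +
      \sum_j \sum_i Z1 p 0 j * Y1 p 0 i * cp p i (c j) p.
  move=> UY1 UZ1; rewrite {1}/act.
  rewrite (@tact_ext _ _ _ _ (fun q => \sum_j act X Z1 (xc p j) q * c j q) oW Wp); last first.
    move=> s [Us ps]; rewrite {1}(vector_coord (Z1 s) ps) pair_sumv.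
    by apply: eq_bigr => j _; rewrite pairZv.
  rewrite (tact_sum _ _ oW Wp) => [|j]; last exact: (csmooth_on_mul oW (UZ1 p j) (Wc j)).
  rewrite -big_split /=; apply: eq_bigr => j _.
  rewrite (tact_mul _ oW Wp (UZ1 p j) (Wc j)) {2}/act tact_coord; congr (_ + _).
  by rewrite /tact mulr_sumr; apply: eq_bigr => i _; rewrite mulrA.
rewrite (expand _ _ UY UZ) (expand _ _ UZ UY).
have -> : Defs.pair (om p) (bracket X Y Z p) =
    \sum_j act X Y (act X Z (xc p j)) p * c j p - \sum_j act X Z (act X Y (xc p j)) p * c j p.
  rewrite -sumrB {1}(vector_coord (bracket X Y Z p) pp) pair_sumv.
  by apply: eq_bigr => j _; rewrite pairZv tact_coord mxE mulrBl.
have -> : (Y p *m dform om p *m (Z p)^T) 0 0 =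
    \sum_j \sum_i Z p 0 j * Y p 0 i * cp p i (c j) p -
    \sum_j \sum_i Y p 0 j * Z p 0 i * cp p i (c j) p.
  rewrite [X in _ - X]exchange_big /= -sumrB mxE; apply: eq_bigr => j _.
  rewrite mxE mulr_suml -sumrB; apply: eq_bigr => i _.
  have alg (a b y z : C) : y * (a - b) * z = z * y * a - y * z * b by ring.
  by rewrite !mxE; exact: alg.
set a := \sum_j _; set b := \sum_j _; set c1 := \sum_j _; set d := \sum_j _.
by ring.
Qed.

(** Cartan's formula Lie_Y om = i_Y d om + d(om(Y)). In each component, [bracket_pair] for Y and
    d/dx_i cancels the derivative along Y. *)
Lemma pair_lie_form U om Y p v : open U -> U p -> smooth_form X om -> smooth_vf X U Y ->
  Defs.pair (lie_form X Y om p) v =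
  (Y p *m dform om p *m v^T) 0 0 + tact X p v (fun q => Defs.pair (om q) (Y q)).
Proof.
move=> oU Up om_s UY; have pp := chart_atP X p.
have oW : open (U `&` dom p) by apply: openI => //; exact: cdom_open.
have Wp : (U `&` dom p) p by [].
have WY : smooth_vf X (U `&` dom p) Y by apply: smooth_vf_subset UY => s [].
have Wdx i : smooth_vf X (U `&` dom p) (dx p i).
  by apply: smooth_vf_subset (smooth_coord_field p i) => s [].
rewrite {1}/Defs.pair mxE [X in X + _]mxE /tact -big_split /=; apply: eq_bigr => i _.
rewrite [lie_form _ _ _ _ _ _]mxE (bracket_pair oW Wp om_s WY (Wdx i)).
rewrite /= coord_field_self.
set g := fun q => Defs.pair (om q) (Y q).
have Wg : csmooth_on X (U `&` dom p) g by exact: om_s.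
have -> : act X (dx p i) g p = cp p i g p by exact: (tact_coord_field i oW Wp pp Wg).
have -> : (Y p *m dform om p *m (delta_mx 0 i : 'rV[C]_m)^T) 0 0 = (Y p *m dform om p) 0 i.
  by rewrite trmx_delta -colE mxE.
have alg (a b d y : C) : y * (a - (a - b - d)) = d * y + y * b by ring.
by rewrite [v^T _ _]mxE; exact: alg.
Qed.

End VectorFields.

(** * Orthonormal frames and the Levi form *)

Section HermitianForm.
Context {R : realType} {m : nat}.
Local Notation C := R[i].
Implicit Types (G : 'M[R]_m) (u v w : 'rV[C]_m).

Lemma hermDl G u v w : herm G (u + v) w = herm G u w + herm G v w.
Proof. by rewrite /herm !mulmxDl mxE. Qed.

Lemma hermZl G (a : C) u v : herm G (a *: u) v = a * herm G u v.
Proof. by rewrite /herm -!scalemxAl mxE. Qed.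

Lemma hermDr G u v w : herm G u (v + w) = herm G u v + herm G u w.
Proof. by rewrite /herm map_mxD linearD /= mulmxDr mxE. Qed.

Lemma hermZr G (a : C) u v : herm G u (a *: v) = Num.conj a * herm G u v.
Proof. by rewrite /herm map_mxZ linearZ /= -scalemxAr mxE. Qed.

Lemma herm0l G v : herm G 0 v = 0.
Proof. by rewrite -(scale0r 0) hermZl mul0r. Qed.

Lemma hermNl G u v : herm G (- u) v = - herm G u v.
Proof. by rewrite -scaleN1r hermZl mulN1r. Qed.

Lemma herm_suml G (I : Type) (s : seq I) (P : pred I) (F : I -> 'rV[C]_m) v :
  herm G (\sum_(i <- s | P i) F i) v = \sum_(i <- s | P i) herm G (F i) v.
Proof.
by elim/big_rec2: _ => [|i y1 y2 _ <-]; rewrite ?herm0l // hermDl.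
Qed.

Lemma herm_conj G u v : G^T = G -> Num.conj (herm G u v) = herm G v u.
Proof.
move=> Gs; rewrite /herm !mxE rmorph_sum; under [RHS]eq_bigr do rewrite mxE mulr_suml.
rewrite exchange_big /=; apply: eq_bigr => j _.
rewrite mxE rmorphM rmorph_sum mulr_suml; apply: eq_bigr => i _.
rewrite !mxE /= rmorphM /= conj_real_complex conjCK.
by rewrite -[in LHS]Gs mxE; ring.
Qed.

Lemma Re_sum (I : Type) (s : seq I) (F : I -> C) :
  complex.Re (\sum_(i <- s) F i) = \sum_(i <- s) complex.Re (F i).
Proof. by apply: (big_morph _ (@ReD R)). Qed.

(** Writing v = a + i b with a and b real, symmetry of G removes the imaginary part and leaves G(a,
    a) + G(b, b). *)
Lemma herm_gt0 G v : G^T = G -> (forall x : 'rV[R]_m, x != 0 -> 0 < (x *m G *m x^T) 0 0) ->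
  v != 0 -> 0 < herm G v v.
Proof.
move=> Gs Gpos v0.
pose a := map_mx (fun z : C => complex.Re z) v; pose b := map_mx (fun z : C => complex.Im z) v.
have Gnn (x : 'rV[R]_m) : 0 <= (x *m G *m x^T) 0 0.
  by have [->|/Gpos/ltW //] := eqVneq x 0; rewrite !mul0mx mxE.
have ReE : complex.Re (herm G v v) = (a *m G *m a^T) 0 0 + (b *m G *m b^T) 0 0.
  rewrite /herm !mxE Re_sum -big_split /=; apply: eq_bigr => j _.
  rewrite !mxE !mulr_suml Re_sum -big_split /=; apply: eq_bigr => i _.
  by rewrite !mxE; case: (v 0 i) => x1 y1; case: (v 0 j) => x2 y2 /=; ring.
have ImE : complex.Im (herm G v v) = 0.
  have := congr1 (fun z : C => complex.Im z) (herm_conj v v Gs).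
  by rewrite Im_conj => /eqP; rewrite eq_sym -addr_eq0 -mulr2n mulrn_eq0 /= => /eqP.
rewrite ltcE ImE eqxx /= ReE.
have [a0|a0] := eqVneq a 0; last by rewrite ltr_pwDl ?Gpos.
have [b0|b0] := eqVneq b 0; last by rewrite ltr_wpDl ?Gpos.
case/negP: v0; apply/eqP/rowP => i; rewrite mxE.
move/rowP: a0 => /(_ i); move/rowP: b0 => /(_ i); rewrite !mxE => bi ai.
exact: complexP.
Qed.

End HermitianForm.

(** * Smooth orthonormal frames of T^{1,0} *)

Section GramSchmidt.
Context {R : realType} {n : nat} {M : topologicalType} {X : manifold R n.*2.+1 M}.
Context {E : CR_structure X} (g : CR_metric E).
Local Notation C := R[i].
Local Notation vfield := (vfield R n.*2.+1 M).
Local Notation hm p := (herm (metric g p)).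

Lemma metric_herm_conj p u v : Num.conj (hm p u v) = hm p v u.
Proof. by apply: herm_conj; exact: (Defs.metric_sym g). Qed.

Lemma metric_herm_gt0 p v : v != 0 -> 0 < hm p v v.
Proof. by apply: herm_gt0; [exact: (Defs.metric_sym g)|exact: (metric_pos g)]. Qed.

(** The coefficients recorded for [L'] are supported on indices below k, so the next residual keeps
    coefficient 1 on the new L_k and cannot vanish at any point of U; dividing by its norm is
    therefore smooth. *)
Lemma gram_schmidt (U : set M) (L : 'I_n -> vfield) : open U ->
  (forall j, smooth_vf X U (L j)) ->
  (forall q, U q -> forall a : 'I_n -> C, \sum_j a j *: L j q = 0 -> forall j, a j = 0) ->
  forall k, (k <= n)%N -> exists L' : 'I_n -> vfield,
  [/\ forall i : 'I_n, (i < k)%N -> smooth_vf X U (L' i),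
      forall q, U q -> forall i : 'I_n, (i < k)%N -> exists2 a : 'I_n -> C,
        L' i q = \sum_j a j *: L j q & forall j : 'I_n, (k <= j)%N -> a j = 0 &
      forall q, U q -> forall i j : 'I_n, (i < k)%N -> (j < k)%N ->
        hm q (L' i q) (L' j q) = (i == j)%:R].
Proof.
move=> oU LU Lfree; elim=> [|k IH] kn; first by exists L; split.
have [L' [L'U L'span L'on]] := IH (ltnW kn).
pose kk := Ordinal kn.
(* The new field minus its projections. [L' i] is constrained only for i < k, and all other indices
   get coefficient 0. *)
pose r : vfield := fun q => L kk q - \sum_(i < n) (if (i < k)%N then hm q (L kk q) (L' i q) else 0) *: L' i q.
have rU : smooth_vf X U r.
  apply: smooth_vf_add => //; apply: smooth_vf_opp => //; apply: smooth_vf_sum => // i.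
  case: (boolP (i < k)%N) => ik.
    by apply: smooth_vf_scale => //; [exact: metric_smooth (LU _) (L'U _ ik)|exact: L'U].
  apply: smooth_vf_ext (smooth_vf_scale oU (csmooth_on_cst X U 0) (LU kk)) => // q _.
  by rewrite !scale0r.
have rorth q : U q -> forall i : 'I_n, (i < k)%N -> hm q (r q) (L' i q) = 0.
  move=> Uq i ik; rewrite hermDl hermNl herm_suml (bigD1 i) //= ik hermZl L'on // eqxx mulr1.
  rewrite big1 => [|j ji]; first by rewrite addr0 subrr.
  by case: ifP => jk; rewrite hermZl ?mul0r // L'on // (negPf ji) mulr0.
have rspan q : U q -> exists b : 'I_n -> C, [/\ r q = \sum_j b j *: L j q, b kk = 1 &
    forall j : 'I_n, (k < j)%N -> b j = 0].
  move=> Uq.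
  have /choice[a Ha] : forall i : 'I_n, exists a : 'I_n -> C, (i < k)%N ->
      L' i q = \sum_j a j *: L j q /\ forall j : 'I_n, (k <= j)%N -> a j = 0.
    move=> i; case: (ltnP i k) => ik; last by exists (fun=> 0).
    by have [a E1 E2] := L'span q Uq i ik; exists a.
  pose c (i : 'I_n) := if (i < k)%N then hm q (L kk q) (L' i q) else 0.
  exists (fun j => (j == kk)%:R - \sum_(i < n) c i * (if (i < k)%N then a i j else 0)); split.
  - rewrite /r; under [RHS]eq_bigr do rewrite scalerBl.
    rewrite sumrB [X in _ = X - _](bigD1 kk) //= eqxx scale1r [X in _ = _ + X - _]big1; last first.
      by move=> j /negPf->; rewrite scale0r.
    rewrite addr0; congr (_ - _).
    under [RHS]eq_bigr do rewrite scaler_suml.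
    rewrite exchange_big /=; apply: eq_bigr => i _; rewrite -/(c i).
    case: (boolP (i < k)%N) => ik; last by rewrite /c (negPf ik) scale0r big1 // => j _; rewrite mul0r scale0r.
    by have [-> _] := Ha i ik; rewrite scaler_sumr; apply: eq_bigr => j _; rewrite scalerA.
  - rewrite eqxx big1 ?subr0 // => i _; case: ifP => ik; last by rewrite mulr0.
    by have [_ ->] := Ha i ik; rewrite ?mulr0 //=.
  - move=> j kj; rewrite -val_eqE /= gtn_eqF // sub0r big1 ?oppr0 // => i _.
    case: ifP => ik; last by rewrite mulr0.
    by have [_ ->] := Ha i ik; rewrite ?mulr0 // ltnW.
have r0 q : U q -> r q != 0.
  move=> Uq; have [b [rE bk _]] := rspan q Uq; apply/eqP => rq0.
  have := Lfree q Uq b; rewrite -rE => /(_ rq0 kk).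
  by rewrite bk => /eqP; rewrite oner_eq0.
pose nr q := complex.Re (hm q (r q) (r q)).
have nr0 q : U q -> 0 < nr q.
  by move=> /r0 /(metric_herm_gt0 q); rewrite ltcE => /andP[_].
have nrE q : U q -> hm q (r q) (r q) = (nr q)%:C.
  move=> /r0 /(metric_herm_gt0 q); rewrite ltcE => /andP[/eqP Im0 _].
  by apply: complexP.
have nrU : smooth_on X U nr by have [] := metric_smooth g oU rU rU.
pose s q : R := (Num.sqrt (nr q))^-1.
have sU : smooth_on X U s.
  apply: smooth_on_inv => //; last exact: smooth_on_sqrt.
  by move=> q Uq; rewrite gt_eqF // sqrtr_gt0 nr0.
have s2 q : U q -> (s q)%:C * ((s q)%:C * (nr q)%:C) = 1.
  move=> Uq; rewrite -!rmorphM /s /=.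
  have nq := nr0 q Uq; rewrite mulrA -invfM -expr2 sqr_sqrtr ?ltW // mulVf ?gt_eqF //.
exists (fun i : 'I_n => if (i < k)%N then L' i else fun q => (s q)%:C *: r q); split.
- move=> i; rewrite ltnS leq_eqVlt; case: ifP => ik; first by move=> _; exact: L'U.
  by move=> _; apply: smooth_vf_scale => //; exact: csmooth_on_cfun.
- move=> q Uq i; rewrite ltnS leq_eqVlt; case: ifP => ik.
    move=> _; have [a aE a0] := L'span q Uq i ik; exists a => // j kj.
    by apply: a0; exact: ltnW.
  move=> _; have [b [rE _ b0]] := rspan q Uq.
  exists (fun j => (s q)%:C * b j) => [|j kj]; last by rewrite b0 ?mulr0.
  by rewrite rE scaler_sumr; apply: eq_bigr => j _; rewrite scalerA.
- move=> q Uq i j; rewrite !ltnS => ik jk.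
  case: ifP => ik'; case: ifP => jk'.
  + exact: L'on.
  + rewrite hermZr -metric_herm_conj rorth // rmorph0 mulr0.
    by rewrite -val_eqE /= ltn_eqF // (leq_trans ik') // leqNgt jk'.
  + by rewrite hermZl rorth // mulr0 -val_eqE /= gtn_eqF // (leq_trans jk') // leqNgt ik'.
  + rewrite hermZl hermZr nrE // conj_real_complex s2 //.
    have eqk (l : 'I_n) : (l <= k)%N -> (l < k)%N = false -> l = kk.
      by move=> lk lk'; apply/val_inj/eqP; rewrite /= eqn_leq lk leqNgt lk'.
    by rewrite (eqk _ ik ik') (eqk _ jk jk') eqxx.
Qed.

(** A local frame of T^{1,0} is orthonormalized, and the dual forms are v |-> <v, L'_i>; the
    orthogonality relations of the metric and of T make them vanish on conj L'_j and T. *)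
Lemma frame_exists (S : CR_orientation g) p : exists F : frame S, fdom F p.
Proof.
have [U [L [oU Up LU Lbasis]]] := T10_smooth E p.
have Lfree q : U q -> forall a : 'I_n -> C, \sum_j a j *: L j q = 0 -> forall j, a j = 0.
  move=> /Lbasis /basis_free Lf a a0.
  have /freeP/(_ a) := (Lf : free [tuple L j q | j < n]); apply.
  by rewrite -[RHS]a0; apply: eq_bigr => j _; rewrite -tnth_nth tnth_mktuple.
have [L' [L'U L'span L'on]] := gram_schmidt oU LU Lfree (leqnn n).
have L'T j q : U q -> L' j q \in T10 E q.
  move=> Uq; have [a -> _] := L'span q Uq j (ltn_ord j).
  apply: memv_suml => i _; apply: memvZ.
  by apply: (basis_mem (Lbasis q Uq)); apply: map_f; rewrite mem_enum.
pose om (i : 'I_n) : form1 R n.*2.+1 M := fun q =>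
  map_mx (real_complex R) (metric g q) *m (map_mx Num.conj (L' i q))^T.
have omE i q v : Defs.pair (om i q) v = hm q v (L' i q) by rewrite /Defs.pair /om mulmxA.
unshelve eexists.
  apply: (@Frame _ _ _ _ _ _ S U L' om) => //.
  - by move=> j; exact: L'U.
  - by move=> i j q Uq; exact: L'on.
  - by move=> i j q Uq; rewrite omE L'on // eq_sym.
  - move=> i j q Uq; rewrite omE -metric_herm_conj (metric_T10_T01 g) ?rmorph0 //; exact: L'T.
  - by move=> i q Uq; rewrite omE Tvf_T10 //; exact: L'T.
by [].
Qed.

End GramSchmidt.

Section ConjugateVectors.
Context {R : realType} {m : nat}.
Local Notation C := R[i].
Implicit Types (v w : tangent R m).

Lemma conjvK v : conjv (conjv v) = v.
Proof. by apply/rowP => i; rewrite !mxE conjCK. Qed.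

Lemma conjvD v w : conjv (v + w) = conjv v + conjv w.
Proof. by rewrite /conjv map_mxD. Qed.

Lemma conjvN v : conjv (- v) = - conjv v.
Proof. by rewrite /conjv map_mxN. Qed.

Lemma conjvZ (a : C) v : conjv (a *: v) = Num.conj a *: conjv v.
Proof. by rewrite /conjv map_mxZ. Qed.

Lemma conjv_sum (I : Type) (s : seq I) (F : I -> tangent R m) :
  conjv (\sum_(i <- s) F i) = \sum_(i <- s) conjv (F i).
Proof.
elim: s => [|i s IH]; last by rewrite !big_cons conjvD IH.
by rewrite !big_nil; apply/rowP => k; rewrite !mxE rmorph0.
Qed.

End ConjugateVectors.

(** * The Levi form as a restriction of d gamma *)

Section LeviForm.
Context {R : realType} {n : nat} {M : topologicalType} {X : manifold R n.*2.+1 M}.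
Context {E : CR_structure X} {g : CR_metric E} (S : CR_orientation g).
Local Notation C := R[i].
Local Notation vfield := (vfield R n.*2.+1 M).
Local Notation tangent := (tangent R n.*2.+1).
Local Notation hm p := (herm (metric g p)).
Implicit Types (F : frame S) (p q : M) (v w l : tangent).

(** The tensor d gamma at p. The Levi form is c(l, V) = - [dgam p l V], which makes sense for single
    vectors, whereas brackets need fields near p. *)
Definition dgam p v w : C := (v *m dform X (gam S) p *m w^T) 0 0.

Lemma dgamDl p v1 v2 w : dgam p (v1 + v2) w = dgam p v1 w + dgam p v2 w.
Proof. by rewrite /dgam !mulmxDl mxE. Qed.

Lemma dgamZl p (a : C) v w : dgam p (a *: v) w = a * dgam p v w.
Proof. by rewrite /dgam -!scalemxAl mxE. Qed.

Lemma dgamDr p v w1 w2 : dgam p v (w1 + w2) = dgam p v w1 + dgam p v w2.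
Proof. by rewrite /dgam linearD /= mulmxDr mxE. Qed.

Lemma dgamZr p (a : C) v w : dgam p v (a *: w) = a * dgam p v w.
Proof. by rewrite /dgam linearZ /= -scalemxAr mxE. Qed.

Lemma dgamNl p v w : dgam p (- v) w = - dgam p v w.
Proof. by rewrite -scaleN1r dgamZl mulN1r. Qed.

Lemma dgamNr p v w : dgam p v (- w) = - dgam p v w.
Proof. by rewrite -scaleN1r dgamZr mulN1r. Qed.

Lemma dgam_suml p (I : Type) (s : seq I) (A : I -> tangent) w :
  dgam p (\sum_(i <- s) A i) w = \sum_(i <- s) dgam p (A i) w.
Proof.
elim: s => [|i s IH]; last by rewrite !big_cons dgamDl IH.
by rewrite !big_nil /dgam !mul0mx mxE.
Qed.

Lemma dgam_sumr p v (I : Type) (s : seq I) (A : I -> tangent) :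
  dgam p v (\sum_(i <- s) A i) = \sum_(i <- s) dgam p v (A i).
Proof.
elim: s => [|i s IH]; last by rewrite !big_cons dgamDr IH.
by rewrite !big_nil /dgam trmx0 mulmx0 mxE.
Qed.

Lemma dgam_anti p v w : dgam p v w = - dgam p w v.
Proof.
have DT : (dform X (gam S) p)^T = - dform X (gam S) p.
  by apply/matrixP => i j; rewrite !mxE opprB.
have -> : dgam p v w = (v *m dform X (gam S) p *m w^T)^T 0 0 by rewrite [RHS]mxE.
by rewrite !trmx_mul trmxK DT mulNmx mulmxN mxE mulmxA.
Qed.

Lemma frame_fLbarE F j p : fLbar F j p = conjv (fL F j p).
Proof. by []. Qed.

(** Orthonormal vectors are free, and n of them fill the n-dimensional T^{1,0}; pairing with each
    frame vector reads off its coefficient. *)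
Lemma frame_basis F p l : fdom F p -> l \in T10 E p ->
  l = \sum_i hm p l (fL F i p) *: fL F i p.
Proof.
move=> Fp lT; pose X0 := [tuple fL F i p | i < n].
have X0E (i : 'I_n) : X0`_i = fL F i p by rewrite -tnth_nth tnth_mktuple.
have cE (c : 'I_n -> C) j : hm p (\sum_i c i *: X0`_i) (fL F j p) = c j.
  rewrite herm_suml (bigD1 j) //= big1 => [|i ij].
    by rewrite X0E hermZl fL_orthonormal // eqxx mulr1 addr0.
  by rewrite X0E hermZl fL_orthonormal // (negPf ij) mulr0.
have X0b : basis_of (T10 E p) X0.
  rewrite basisEfree T10_dim size_tuple leqnn andbT; apply/andP; split.
    by apply/freeP => c c0 j; rewrite -(cE c j) c0 herm0l.
  apply/span_subvP => v /tnthP[i ->]; rewrite tnth_mktuple; exact: fL_T10.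
pose c i := coord X0 i l.
have lE : l = \sum_i c i *: X0`_i := coord_basis X0b lT.
rewrite [LHS]lE; apply: eq_bigr => i _.
by rewrite X0E; congr (_ *: _); rewrite -(cE c i) -lE.
Qed.

Lemma act_vanish Y U p (f : M -> C) (a : C) : open U -> U p -> (forall q, U q -> f q = a) ->
  act X Y f p = 0.
Proof.
move=> oU Up f0; rewrite /act (@tact_ext _ _ _ X p U _ f (fun=> a) oU Up) //.
exact: tact_cst.
Qed.

(** Constant pairings kill both derivative terms of Cartan's formula. The constants used are 0 for
    L_j and conj L_j, and 1 for T. *)
Lemma bracket_dgam U (Y Z : vfield) (a b : C) p : open U -> U p -> smooth_vf X U Y -> smooth_vf X U Z ->
  (forall q, U q -> Defs.pair (gam S q) (Y q) = a) ->
  (forall q, U q -> Defs.pair (gam S q) (Z q) = b) ->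
  Defs.pair (gam S p) (bracket X Y Z p) = - dgam p (Y p) (Z p).
Proof.
move=> oU Up UY UZ gY gZ; rewrite (bracket_pair oU Up (gam_smooth S) UY UZ).
by rewrite (act_vanish Y oU Up gZ) (act_vanish Z oU Up gY) subr0 sub0r.
Qed.

Lemma gam_frame F i p : fdom F p -> Defs.pair (gam S p) (fL F i p) = 0.
Proof. by move=> Fp; rewrite gam_T10 // fL_T10. Qed.

Lemma gam_frame_bar F i p : fdom F p -> Defs.pair (gam S p) (fLbar F i p) = 0.
Proof. by move=> Fp; rewrite gam_T01 // fL_T10. Qed.

Lemma smooth_fLbar F i : smooth_vf X (fdom F) (fLbar F i).
Proof. by apply: smooth_vf_conj; [exact: fdom_open|exact: fL_smooth]. Qed.

Lemma leviE F p i j : fdom F p -> levi F p i j = - dgam p (fL F i p) (fLbar F j p).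
Proof.
move=> Fp; rewrite mxE.
exact: (bracket_dgam (fdom_open F) Fp (fL_smooth F i) (smooth_fLbar F j)
  (fun q => @gam_frame F i q) (fun q => @gam_frame_bar F j q)).
Qed.

(** This is where involutivity enters: [L_i, L_j] lies in T^{1,0}, on which gamma vanishes, and
    bilinearity does the rest. *)
Lemma dgam_T10 p v w : v \in T10 E p -> w \in T10 E p -> dgam p v w = 0.
Proof.
have [F Fp] := frame_exists S p.
move=> vT wT; rewrite (frame_basis Fp vT) (frame_basis Fp wT) dgam_suml big1 // => i _.
rewrite dgam_sumr big1 // => j _; rewrite dgamZl dgamZr.
have := bracket_dgam (fdom_open F) Fp (fL_smooth F i) (fL_smooth F j)
  (fun q => @gam_frame F i q) (fun q => @gam_frame F j q).
rewrite gam_T10; first by move/eqP; rewrite eq_sym oppr_eq0 => /eqP ->; rewrite !mulr0.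
apply: (T10_involutive (fdom_open F) (fL_smooth F i) (fL_smooth F j)) Fp.
  by move=> q; exact: fL_T10.
by move=> q; exact: fL_T10.
Qed.

Lemma alphaE U (Y : vfield) p v : open U -> U p -> smooth_vf X U Y ->
  Defs.pair (alpha S Y p) v =
  - dgam p (Y p) v - tact X p v (fun q => Defs.pair (gam S q) (Y q)).
Proof.
move=> oU Up UY; rewrite /alpha -opprD -(pair_lie_form v oU Up (gam_smooth S) UY).
by rewrite /Defs.pair mulmxN mxE.
Qed.

Lemma alpha_TvfE p v : Defs.pair (alpha S (Tvf S) p) v = - dgam p (Tvf S p) v.
Proof.
rewrite (alphaE v openT (I : setT p) (Tvf_smooth S)).
rewrite (@tact_ext _ _ _ X p setT v _ (fun=> 1) openT I) ?tact_cst ?subr0 // => q _.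
exact: gam_T.
Qed.

Lemma alpha_Tvf_frame F i p : fdom F p ->
  Defs.pair (alpha S (Tvf S) p) (fL F i p) = Defs.pair (gam S p) (bracket X (Tvf S) (fL F i) p).
Proof.
move=> Fp; rewrite alpha_TvfE.
have UT : smooth_vf X (fdom F) (Tvf S) by apply: smooth_vf_subset (Tvf_smooth S).
by rewrite (bracket_dgam (fdom_open F) Fp UT (fL_smooth F i) (fun q _ => gam_T S q)
  (fun q => @gam_frame F i q)).
Qed.

Lemma hquad_dgam F p (xi : 'rV[C]_n) : fdom F p ->
  hquad (levi F p) xi =
  - dgam p (\sum_i xi 0 i *: fL F i p) (conjv (\sum_i xi 0 i *: fL F i p)).
Proof.
move=> Fp; rewrite conjv_sum dgam_suml -sumrN; apply: eq_bigr => i _.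
rewrite dgam_sumr -sumrN; apply: eq_bigr => j _.
by rewrite conjvZ dgamZl dgamZr leviE //= -frame_fLbarE; ring.
Qed.

Lemma herm_frame_sum F p (x y : 'I_n -> C) : fdom F p ->
  hm p (\sum_i x i *: fL F i p) (\sum_i y i *: fL F i p) = \sum_i x i * Num.conj (y i).
Proof.
move=> Fp; rewrite herm_suml; apply: eq_bigr => i _; rewrite hermZl; congr (_ * _).
rewrite -metric_herm_conj herm_suml (bigD1 i) //= big1 => [|j ji].
  by rewrite hermZl fL_orthonormal // eqxx mulr1 addr0.
by rewrite hermZl fL_orthonormal // (negPf ji) mulr0.
Qed.

Lemma dgam_ge0 p l : pseudoconvex S -> l \in T10 E p -> 0 <= - dgam p l (conjv l).
Proof.
move=> PC lT; have [F Fp] := frame_exists S p.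
have := PC F p Fp (\row_i hm p l (fL F i p)); rewrite hquad_dgam //.
have -> // : \sum_i (\row_i hm p l (fL F i p)) 0 i *: fL F i p = l.
by rewrite [RHS](frame_basis Fp lT); apply: eq_bigr => i _; rewrite mxE.
Qed.

End LeviForm.

(** * The regularized correction *)

Section ShiftedMatrix.
Context {R : realType} {n : nat}.
Local Notation C := R[i].
Implicit Types (c : 'M[C]_n) (xi : 'rV[C]_n) (x y w e : 'cV[C]_n) (d : R).

Lemma sqnorm_ge0 xi : 0 <= sqnorm xi.
Proof. by apply: sumr_ge0 => j _; exact: exprn_ge0. Qed.

Lemma sqnorm_eq0 xi : sqnorm xi = 0 -> xi = 0.
Proof.
move=> /eqP; rewrite psumr_eq0 => [/allP H|j _]; last exact: exprn_ge0.
apply/rowP => j; rewrite mxE; have := H j (mem_index_enum _).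
by rewrite /= expf_eq0 normr_eq0 /= => /eqP.
Qed.

Lemma sqnorm_le2 xi eta : sqnorm (xi + eta) <= 2 * (sqnorm xi + sqnorm eta).
Proof.
rewrite /sqnorm -big_split mulr_sumr; apply: ler_sum => j _; rewrite mxE /=.
have -> : 2 * (`|xi 0 j| ^+ 2 + `|eta 0 j| ^+ 2) =
  `|xi 0 j + eta 0 j| ^+ 2 + `|xi 0 j - eta 0 j| ^+ 2.
  by rewrite !normCK !rmorphD rmorphN /=; ring.
by rewrite lerDl exprn_ge0.
Qed.

Lemma hquad_mulmx c xi : hquad c xi = (xi *m c *m (map_mx Num.conj xi)^T) 0 0.
Proof.
rewrite /hquad exchange_big mxE /=; apply: eq_bigr => j _.
by rewrite mxE mulr_suml; apply: eq_bigr => i _; rewrite !mxE; ring.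
Qed.

(** Expanding, |c y + d y|^2 = |c y|^2 + d^2 |y|^2 + 2 d Re <c y, y>, and the cross term is
    nonnegative. The two conclusions are the contraction bounds for d (c + d)^-1 and c (c + d)^-1,
    stated without the inverse. *)
Lemma shifted_sqnorm c y d : (forall xi, 0 <= hquad c xi) -> 0 < d ->
  d%:C ^+ 2 * sqnorm y^T <= sqnorm ((c + d%:C%:M) *m y)^T /\
  sqnorm (c *m y)^T <= sqnorm ((c + d%:C%:M) *m y)^T.
Proof.
move=> cpos d0; pose q := \sum_i (c *m y) i 0 * Num.conj (y i 0).
have q0 : 0 <= q.
  (* [hquad] conjugates the column index and q the row index, whence the conjugate of y. *)
  have -> // : q = hquad c (map_mx Num.conj y^T).
  rewrite /q /hquad; apply: eq_bigr => i _; rewrite mxE mulr_suml.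
  by apply: eq_bigr => j _; rewrite !mxE conjCK; ring.
have dC : 0 <= d%:C :> C by rewrite ler0c ltW.
have gen (z : 'cV[C]_n) : sqnorm (z + d%:C *: y)^T = sqnorm z^T + d%:C ^+ 2 * sqnorm y^T +
    d%:C * (\sum_i z i 0 * Num.conj (y i 0) + Num.conj (\sum_i z i 0 * Num.conj (y i 0))).
  rewrite /sqnorm rmorph_sum /= !mulrDr !mulr_sumr -!big_split /=; apply: eq_bigr => i _.
  rewrite !mxE !normCK !rmorphD !rmorphM /= conjCK conj_real_complex.
  by move: (z i 0) (y i 0) => a b; ring.
have E := gen (c *m y).
rewrite -/q -mul_scalar_mx -mulmxDl in E.
have cq : 0 <= d%:C * (q + Num.conj q) by rewrite mulr_ge0 // addr_ge0 // conjC_ge0.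
rewrite E; split.
  by rewrite addrAC lerDr addr_ge0 // sqnorm_ge0.
by rewrite -addrA lerDl addr_ge0 // mulr_ge0 ?exprn_ge0 // sqnorm_ge0.
Qed.

(** The lower bound d^2 |y|^2 <= |(c + d) y|^2 leaves no kernel. *)
Lemma shifted_unit c d : (forall xi, 0 <= hquad c xi) -> 0 < d -> c + d%:C%:M \in unitmx.
Proof.
move=> cpos d0; rewrite -unitmx_tr -row_free_unit -kermx_eq0.
apply/eqP/row_matrixP => i; rewrite row0.
set v := row i _; have : v *m (c + d%:C%:M)^T = 0 by rewrite /v -row_mul mulmx_ker row0.
move=> /(congr1 trmx); rewrite trmx_mul trmxK trmx0 => v0.
have [H _] := shifted_sqnorm v^T cpos d0; move: H; rewrite v0 trmxK.
have -> : sqnorm (0 : 'cV[C]_n)^T = 0.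
  by apply: big1 => j _; rewrite !mxE normr0 expr0n.
rewrite pmulr_rle0; last by rewrite exprn_gt0 // ltcR.
move=> H; apply: sqnorm_eq0; apply/eqP; rewrite eq_le H; exact: sqnorm_ge0.
Qed.

(** The column space of c is the annihilator of its left kernel, which [(cokermx c^T)^T] spans. Null
    vectors of the Levi form are such row vectors, so exactness on them becomes solvability of theta
    = c w. *)
Lemma left_kernel_range c x : (forall xi, xi *m c = 0 -> xi *m x = 0) -> exists w, x = c *m w.
Proof.
move=> H.
have kc : (cokermx c^T)^T *m c = 0 by apply: trmx_inj; rewrite trmx_mul trmxK trmx0 mulmx_coker.
have kx : (cokermx c^T)^T *m x = 0.
  apply/row_matrixP => i; rewrite row_mul row0; apply: H.
  by rewrite -row_mul kc row0.
have /submxP[w wE] : (x^T <= c^T)%MS.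
  by rewrite submxE -[cokermx _]trmxK -trmx_mul kx trmx0.
by exists w^T; rewrite -[LHS]trmxK wE trmx_mul trmxK.
Qed.

(** As c commutes with (c + d)^-1, the part of the solution coming from c w is bounded by w, while d
    times the part coming from e is bounded by e. The factor 2 is the price of squaring a sum. *)
Lemma shifted_solution_bound c w e d : (forall xi, 0 <= hquad c xi) -> 0 < d ->
  d%:C ^+ 2 * sqnorm (invmx (c + d%:C%:M) *m (c *m w + e))^T <=
  2 * (d%:C ^+ 2 * sqnorm w^T + sqnorm e^T).
Proof.
move=> cpos d0; have cu := shifted_unit cpos d0.
set A := c + d%:C%:M in cu *.
have cAi : invmx A *m c = c *m invmx A.
  have AC : A *m c = c *m A.
    by rewrite /A mulmxDl mulmxDr scalar_mxC.
  by rewrite -[LHS](mulmxK cu) -(mulmxA _ c) -AC !mulmxA mulVmx // mul1mx.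
rewrite mulmxDr linearD /=.
apply: le_trans (_ : d%:C ^+ 2 * (2 * (sqnorm (invmx A *m (c *m w))^T + sqnorm (invmx A *m e)^T)) <= _).
  by rewrite ler_wpM2l ?exprn_ge0 ?ler0c ?(ltW d0) // sqnorm_le2.
rewrite mulrCA ler_pM2l ?ltr0n // mulrDr lerD //.
  rewrite ler_wpM2l ?exprn_ge0 ?ler0c ?(ltW d0) //.
  have [_] := shifted_sqnorm (invmx A *m w) cpos d0.
  by rewrite -/A mulmxA -cAi -(mulmxA (invmx A)) (mulmxA A) mulmxV // mul1mx.
have [H _] := shifted_sqnorm (invmx A *m e) cpos d0.
by apply: le_trans H _; rewrite -/A mulmxA mulmxV // mul1mx.
Qed.

End ShiftedMatrix.

(** * The corrected field and its form alpha on T^{1,0} *)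

Section CorrectedField.
Context {R : realType} {n : nat} {M : topologicalType} {X : manifold R n.*2.+1 M}.
Context {E : CR_structure X} {g : CR_metric E} (S : CR_orientation g).
Local Notation C := R[i].
Local Notation vfield := (vfield R n.*2.+1 M).
Local Notation tangent := (tangent R n.*2.+1).
Local Notation hm p := (herm (metric g p)).
Implicit Types (F : frame S) (p q : M) (v l : tangent) (V : tangent).
Variable H : M -> R.
Hypothesis H_smooth : smooth_on X setT H.
Hypothesis S_pc : pseudoconvex S.

Let f : M -> R := expR \o H.

(* Up to the term in V, the form [alpha] of [e^H T + V - conj V] on T^{1,0}. *)
Definition theta p l : C :=
  (expR (H p))%:C * (Defs.pair (alpha S (Tvf S) p) l - tact X p l (cfun H)).

Lemma theta_sum p (I : Type) (s : seq I) (a : I -> C) (A : I -> tangent) :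
  theta p (\sum_(i <- s) a i *: A i) = \sum_(i <- s) a i * theta p (A i).
Proof.
rewrite /theta pair_sumv tact_sumv -sumrB mulr_sumr; apply: eq_bigr => i _.
by rewrite pairZv tactZv; ring.
Qed.

Definition regularized d p V : Prop := conjv V \in T10 E p /\
  forall l, l \in T10 E p -> - dgam S p l V + d%:C * hm p l (conjv V) = theta p l.

(* The equation [regularized] in the frame [F]; see [reg_sol_regularized]. *)
Definition reg_coef d F p : 'cV[C]_n :=
  invmx (levi F p + d%:C%:M) *m \col_i theta p (fL F i p).

Definition reg_sol d F p : tangent := \sum_j reg_coef d F p j 0 *: fLbar F j p.

Lemma levi_pos F p : fdom F p -> forall xi, 0 <= hquad (levi F p) xi.
Proof. exact: S_pc. Qed.

Lemma conj_reg_sol d F p :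
  conjv (reg_sol d F p) = \sum_j Num.conj (reg_coef d F p j 0) *: fL F j p.
Proof.
by rewrite conjv_sum; apply: eq_bigr => j _; rewrite conjvZ frame_fLbarE conjvK.
Qed.

Lemma herm_reg_sol d F p i : fdom F p ->
  hm p (fL F i p) (conjv (reg_sol d F p)) = reg_coef d F p i 0.
Proof.
move=> Fp; have -> : fL F i p = \sum_j (j == i)%:R *: fL F j p.
  rewrite (bigD1 i) //= eqxx scale1r big1 ?addr0 // => j /negPf ->.
  by rewrite scale0r.
rewrite conj_reg_sol herm_frame_sum // (bigD1 i) //= eqxx mul1r conjCK big1 ?addr0 //.
by move=> j /negPf ->; rewrite mul0r.
Qed.

Lemma reg_sol_regularized d F p : 0 < d -> fdom F p -> regularized d p (reg_sol d F p).
Proof.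
move=> d0 Fp; split.
  rewrite conj_reg_sol; apply: memv_suml => j _; apply: memvZ; exact: fL_T10.
move=> l lT; rewrite (frame_basis Fp lT); set x := fun i => hm p l (fL F i p).
rewrite theta_sum dgam_suml herm_suml mulr_sumr -sumrN -big_split /=.
apply: eq_bigr => i _; rewrite dgamZl hermZl herm_reg_sol //.
rewrite /reg_sol dgam_sumr.
have eqn : (levi F p + d%:C%:M) *m reg_coef d F p = \col_i theta p (fL F i p).
  by rewrite /reg_coef mulmxA mulmxV ?mul1mx // shifted_unit //; exact: levi_pos.
have := congr1 (fun A : 'cV[C]_n => A i 0) eqn; rewrite [RHS]mxE => <-.
have -> : ((levi F p + d%:C%:M) *m reg_coef d F p) i 0 =
    \sum_j levi F p i j * reg_coef d F p j 0 + d%:C * reg_coef d F p i 0.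
  by rewrite mulmxDl mul_scalar_mx mxE [X in _ + X]mxE [X in X + _]mxE.
rewrite mulrDr.
rewrite -mulrN -sumrN; congr (_ + _); last by rewrite mulrCA.
congr (_ * _); apply: eq_bigr => j _.
by rewrite dgamZr leviE // mulNr mulrC.
Qed.

(** Subtracting the two equations and testing on l = conj (V1 - V2) gives c(l, conj l) + d |l|^2 =
    0, where the first term is nonnegative and the second is positive unless l = 0. *)
Lemma regularized_unique d p V1 V2 : 0 < d -> regularized d p V1 -> regularized d p V2 -> V1 = V2.
Proof.
move=> d0 [T1 E1] [T2 E2]; pose l := conjv (V1 - V2).
have lE : l = conjv V1 - conjv V2 by rewrite /l conjvD conjvN.
have lT : l \in T10 E p by rewrite lE memvB.
have lK : conjv l = V1 - V2 by rewrite /l conjvK.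
have h0 : - dgam S p l (conjv l) + d%:C * hm p l l = 0.
  have -> : hm p l l = hm p l (conjv V1) - hm p l (conjv V2).
    by rewrite {2}lE hermDr -scaleN1r hermZr rmorphN rmorph1 mulN1r.
  rewrite lK dgamDr dgamNr mulrBr.
  have := E1 l lT; rewrite -(E2 l lT) => /eqP; rewrite -subr_eq0 => /eqP <-.
  by ring.
have [l0|/(metric_herm_gt0 g p) lpos] := eqVneq l 0.
  apply/eqP; rewrite -subr_eq0 -lK l0; apply/eqP/rowP => k.
  by rewrite !mxE rmorph0.
have : 0 < - dgam S p l (conjv l) + d%:C * hm p l l.
  by rewrite ltr_wpDl ?dgam_ge0 // mulr_gt0 // ltcR.
by rewrite h0 ltxx.
Qed.

Lemma frame_at p : {F : frame S | fdom F p}.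
Proof. exact: (cid (frame_exists S p)). Qed.

(** The frame is chosen point by point without any continuity; uniqueness identifies the result with
    [reg_sol] in any one frame, where smoothness is visible. *)
Definition reg_field d : vfield := fun p => reg_sol d (sval (frame_at p)) p.

Lemma reg_fieldE d F p : 0 < d -> fdom F p -> reg_field d p = reg_sol d F p.
Proof.
move=> d0 Fp; apply: (regularized_unique d0); apply: reg_sol_regularized => //.
exact: (svalP (frame_at p)).
Qed.

Lemma smooth_theta F i : csmooth_on X (fdom F) (fun p => theta p (fL F i p)).
Proof.
have oF := fdom_open F.
have UT : smooth_vf X (fdom F) (Tvf S) by apply: smooth_vf_subset (Tvf_smooth S).
have UH : smooth_on X (fdom F) H by apply: smooth_on_subset H_smooth.
apply: (csmooth_on_mul oF).
  by apply: csmooth_on_cfun; exact: smooth_on_expR.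
apply: (csmooth_on_sub oF).
  have := gam_smooth S oF (smooth_bracket oF UT (fL_smooth F i)).
  by apply: csmooth_on_ext => // p Fp; rewrite alpha_Tvf_frame.
exact: (smooth_act oF (fL_smooth F i) (csmooth_on_cfun UH)).
Qed.

Lemma smooth_levi F i j : csmooth_on X (fdom F) (fun p => levi F p i j).
Proof.
have oF := fdom_open F.
have := gam_smooth S oF (smooth_bracket oF (fL_smooth F i) (smooth_fLbar F j)).
by apply: csmooth_on_ext => // p Fp; rewrite mxE.
Qed.

Lemma smooth_reg_coef d F i : 0 < d -> csmooth_on X (fdom F) (fun p => reg_coef d F p i 0).
Proof.
move=> d0; have oF := fdom_open F.
have H1 : csmooth_on X (fdom F)
    (fun p => \sum_j invmx (levi F p + d%:C%:M) i j * theta p (fL F j p)).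
  apply: (csmooth_on_sum _ oF) => j; apply: (csmooth_on_mul oF _ (smooth_theta F j)).
  apply: csmooth_on_invmx => //.
    by move=> q Fq; apply: shifted_unit => //; exact: levi_pos.
  move=> k1 k2.
  apply: csmooth_on_ext (csmooth_on_add oF (smooth_levi F k1 k2)
    (csmooth_on_cst X _ ((d%:C%:M : 'M[C]_n) k1 k2))) => // q _.
  by rewrite [RHS]mxE.
apply: csmooth_on_ext H1 => // q _.
by rewrite [RHS]mxE; apply: eq_bigr => j _; rewrite [X in _ = _ * X]mxE.
Qed.

Lemma smooth_reg_field d : 0 < d -> smooth_vf X setT (reg_field d).
Proof.
move=> d0; apply: smooth_vf_local => p _; have [F Fp] := frame_exists S p.
have oF := fdom_open F; exists (fdom F); split=> //.
have H1 : smooth_vf X (fdom F) (fun q => \sum_j reg_coef d F q j 0 *: fLbar F j q).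
  apply: (smooth_vf_sum _ oF) => j.
  exact: (smooth_vf_scale oF (smooth_reg_coef F j d0) (smooth_fLbar F j)).
by apply: smooth_vf_ext H1 => // q Fq; rewrite (reg_fieldE d0 Fq).
Qed.

Definition Teps d : vfield := fun p =>
  (expR (H p))%:C *: Tvf S p + (reg_field d p - conjv (reg_field d p)).

Lemma smooth_Teps d : 0 < d -> smooth_vf X setT (Teps d).
Proof.
move=> d0; have V := smooth_reg_field d0.
apply: (smooth_vf_add openT); last first.
  exact: (smooth_vf_add openT V (smooth_vf_opp openT (smooth_vf_conj openT V))).
apply: (smooth_vf_scale openT _ (Tvf_smooth S)).
by apply: csmooth_on_cfun; apply: smooth_on_expR => //; exact: openT.
Qed.

Lemma Teps_imag d p : conjv (Teps d p) = - Teps d p.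
Proof.
rewrite /Teps conjvD conjvZ conj_real_complex Tvf_imag conjvD conjvN conjvK.
by rewrite scalerN !opprD opprK [conjv _ - _]addrC.
Qed.

Lemma reg_field_T10 d p : 0 < d -> conjv (reg_field d p) \in T10 E p.
Proof.
by move=> d0; have [] := reg_sol_regularized d0 (svalP (frame_at p)).
Qed.

(** V lies in T^{0,1} and conj V in T^{1,0}, both killed by gamma. The value is free of d, so bounds
    on it are automatically uniform. *)
Lemma gam_Teps d p : 0 < d -> Defs.pair (gam S p) (Teps d p) = (expR (H p))%:C.
Proof.
move=> d0; have VT := reg_field_T10 p d0.
rewrite /Teps pairDv pairZv gam_T mulr1 pairDv pairNv (gam_T10 S VT).
by rewrite -[X in Defs.pair _ X]conjvK (gam_T01 S VT) subr0 addr0.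
Qed.

Lemma tact_cfun_expR p l : tact X p l (cfun f) = (expR (H p))%:C * tact X p l (cfun H).
Proof.
rewrite /tact mulr_sumr; apply: eq_bigr => i _.
rewrite (chart_partial_cfun_expR (I : setT p) (chart_atP X p) i H_smooth).
by rewrite mulrCA.
Qed.

(** The contribution of conj V is d gamma on two vectors of T^{1,0}, hence zero; antisymmetry turns
    that of V into - c(l, V), and the equation for V absorbs theta. *)
Lemma alpha_Teps d p l : 0 < d -> l \in T10 E p ->
  Defs.pair (alpha S (Teps d) p) l = d%:C * hm p l (conjv (reg_field d p)).
Proof.
move=> d0 lT; rewrite (alphaE S l openT (I : setT p) (smooth_Teps d0)).
have -> : (fun q => Defs.pair (gam S q) (Teps d q)) = cfun f.
  by apply/funext => q; rewrite gam_Teps.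
rewrite tact_cfun_expR /Teps dgamDl dgamZl dgamDl dgamNl.
rewrite (dgam_T10 S (reg_field_T10 p d0) lT) subr0 [dgam S p (reg_field d p) l]dgam_anti.
have [_ /(_ l lT)] := reg_sol_regularized d0 (svalP (frame_at p)).
rewrite -/(reg_field d p) => e1.
have {e1}-> : d%:C * hm p l (conjv (reg_field d p)) =
    theta p l + dgam S p l (reg_field d p) by rewrite -e1; ring.
by rewrite /theta alpha_TvfE; ring.
Qed.

Lemma alpha_sqnorm_Teps d F p : 0 < d -> fdom F p ->
  alpha_sqnorm F (Teps d) p = 2 * (d%:C ^+ 2 * sqnorm (reg_coef d F p)^T).
Proof.
move=> d0 Fp; rewrite /alpha_sqnorm /sqnorm; congr (_ * _); rewrite mulr_sumr.
apply: eq_bigr => j _; rewrite alpha_Teps ?fL_T10 // (reg_fieldE d0 Fp) herm_reg_sol //.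
have dn : `|d%:C : C| = d%:C by apply: ger0_norm; rewrite ler0c ltW.
by rewrite normrM exprMn dn [in RHS]mxE.
Qed.

(** Both sides are the squared length of conj V. Estimates made in one frame near a point thereby
    pass to an arbitrary frame. *)
Lemma sqnorm_reg_coef_frame d F F' p : 0 < d -> fdom F p -> fdom F' p ->
  sqnorm (reg_coef d F p)^T = sqnorm (reg_coef d F' p)^T.
Proof.
move=> d0; have main F1 : fdom F1 p ->
    sqnorm (reg_coef d F1 p)^T = hm p (conjv (reg_field d p)) (conjv (reg_field d p)).
  move=> Fp; rewrite (reg_fieldE d0 Fp) conj_reg_sol herm_frame_sum //.
  by apply: eq_bigr => j _; rewrite mxE normCK conjCK mulrC.
by move=> /main -> /main ->.
Qed.

End CorrectedField.

(** * Cutting off the potential *)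

(* The library's [compact_cover] asks for a pointed space. *)
Lemma compact_finite_cover (T : topologicalType) (O : T -> set T) : compact [set: T] ->
  (forall p, open (O p) /\ O p p) -> exists s : seq T, forall x, exists2 p, p \in s & O p x.
Proof.
move=> /compact_near_coveringP cT OP.
(* The filter of all sufficiently large finite lists. A property that holds near each point for all
   large lists then holds at every point for a single list. *)
pose F : set_system (seq T) := fun A =>
  exists s0 : seq T, forall s : seq T, {subset s0 <= s} -> A s.
have FF : Filter F.
  split=> [|A B [s1 h1] [s2 h2]|A B AB [s0 h]]; first by exists [::].
    exists (s1 ++ s2) => s ss; split; [apply: h1|apply: h2] => x xs; apply: ss;
    by rewrite mem_cat xs ?orbT.
  by exists s0 => s /h /AB.
have [x _|s0 h] := cT (seq T) F (fun s x => exists2 p, p \in s & O p x) FF.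
  have [oO Ox] := OP x.
  exists (O x, (fun s : seq T => is_true (x \in s)) : set (seq T)).
    split=> /=; first exact: open_nbhs_nbhs.
    by exists [:: x] => s; apply; rewrite mem_head.
  by move=> [y s] [/= Oy xs]; exists x.
by exists s0 => x; apply: h.
Qed.

Section Cutoff.
Context {R : realType} {m : nat} {M : topologicalType} (X : manifold R m M).
Implicit Types (p q : M) (U W Z : set M).

Local Notation dom p := (cdom (chart_at X p)).
Local Notation map p := (cmap (chart_at X p)).
Local Notation inv p := (cinv (chart_at X p)).

(** A Euclidean ball: closed as a sublevel set of a continuous function, and bounded because (1 +
    |r|)^2 >= |r| gives |x_i - x0_i| <= 1 + |r| without a square root. *)
Lemma coord_box_compact (x0 : 'rV[R]_m) (r : R) :
  compact [set x : 'rV[R]_m | \sum_i (x 0 i - x0 0 i) ^+ 2 <= r].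
Proof.
have cont : continuous (fun x : 'rV[R]_m => \sum_i (x 0 i - x0 0 i) ^+ 2).
  apply: continuous_big => [|i _]; first exact: add_continuous.
  move=> x; have c1 : {for x, continuous (fun x : 'rV[R]_m => x 0 i - x0 0 i)}.
    exact: (cvgB (@coord_continuous _ _ _ 0 i x) (cvg_cst _)).
  exact: (cvgM c1 c1).
apply: bounded_closed_compact; last first.
  exact: (@closed_comp _ _ _ [set y : R | y <= r] (fun x _ => cont x) (@closed_le _ r)).
exists (`|x0| + (1 + `|r|)); split; first exact: num_real.
move=> b /ltW hb x /= xr; apply: le_trans hb.
rewrite -[x in leLHS](subrK x0) addrC; apply: (le_trans (ler_normD _ _)); rewrite lerD2l.
rewrite [leLHS]/Num.Def.normr/= mx_normrE; apply: bigmax_le => [|[k i] _ /=]; first by rewrite addr_ge0.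
rewrite ord1 !mxE; set t := x 0 i - x0 0 i.
have t2 : t ^+ 2 <= `|r|.
  apply: le_trans (ler_norm r); apply: le_trans xr.
  by rewrite (bigD1 i) //= lerDl sumr_ge0 // => j _; exact: sqr_ge0.
rewrite -(@ler_pXn2r _ 2) ?nnegrE ?addr_ge0 // real_normK ?num_real //; apply: (le_trans t2).
have -> : (1 + `|r|) ^+ 2 = `|r| + (1 + `|r| + `|r| ^+ 2) by ring.
by rewrite lerDl !addr_ge0 // exprn_ge0.
Qed.

(** With rho the squared distance to p in its chart, the quotient of flat functions is 1 for rho <
    r/2 and 0 for rho >= r. The set Z is the image of a compact ball, closed because M is Hausdorff,
    so extension by zero outside the chart is smooth. *)
Lemma bump_exists p W : open W -> W p -> exists (chi : M -> R) (Z O : set M),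
  [/\ smooth_on X setT chi, closed Z, Z `<=` W & forall q, ~ Z q -> chi q = 0] /\
  [/\ open O, O p & forall q, O q -> chi q = 1].
Proof.
move=> oW Wp; have pp := chart_atP X p; pose x0 := map p p.
have oI := @open_img _ _ _ X p _ oW.
have Ix0 : (map p @` (dom p `&` W)) x0 by exact: img_mem.
have [e /= e0 He] := (nbhs_ballP _ _).1 (open_nbhs_nbhs (conj oI Ix0)).
(* The closed Euclidean ball of radius e/2 lies in the open ball of radius e for the maximum
   norm. *)
pose r := (e / 2) ^+ 2.
have r0 : 0 < r by rewrite exprn_gt0 // divr_gt0.
pose B := [set x : 'rV[R]_m | \sum_i (x 0 i - x0 0 i) ^+ 2 <= r].
have BI : B `<=` map p @` (dom p `&` W).
  move=> x Bx; apply: He; rewrite -ball_normE /= distrC.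
  apply: (@le_lt_trans _ _ (e / 2)); last by rewrite ltr_pdivrMr // ltr_pMr // ltr1n.
  rewrite [leLHS]/Num.Def.normr/= mx_normrE; apply: bigmax_le => [|[k i] _ /=].
    by rewrite divr_ge0 // ltW.
  rewrite ord1 !mxE -(@ler_pXn2r _ 2) ?nnegrE ?divr_ge0 ?(ltW e0) // real_normK ?num_real //.
  apply: le_trans Bx; rewrite (bigD1 i) //= lerDl sumr_ge0 // => j _; exact: sqr_ge0.
pose Z := inv p @` B.
have ZW : Z `<=` dom p `&` W.
  by move=> _ [x /BI [s [ps Ws] <-] <-]; rewrite chart_mapK.
have cZ : closed Z.
  apply: compact_closed; first exact: manifold_hausdorff X.
  apply: continuous_compact; last exact: coord_box_compact.
  apply: continuous_in_subspaceT => x /set_mem /BI [s [ps Ws] <-].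
  by apply: cinv_cont; apply: mem_set; exists s.
pose rho q := \sum_i (map p q 0 i - x0 0 i) ^+ 2.
pose num q := flat 0 (r - rho q).
pose den q := num q + flat 0 (rho q - r / 2).
(* The first summand is positive for rho < r and the second for rho > r/2; one of the two always
   holds. *)
have den0 q : den q != 0.
  rewrite gt_eqF // /den /num; case: (ltP (rho q) r) => h.
    by rewrite ltr_pwDl ?flat_ge0 // flat_gt0 // subr_gt0.
  rewrite ltr_wpDl ?flat_ge0 // flat_gt0 // subr_gt0 (lt_le_trans _ h) //.
  by rewrite ltr_pdivrMr // ltr_pMr // ltr1n.
pose chi q := if `[< dom p q >] then num q / den q else 0.
have oD : open (dom p) by exact: cdom_open.
have rho_s : smooth_on X (dom p) rho.
  apply: (smooth_on_sum _ oD) => i.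
  have H : smooth_on X (dom p) (fun q => map p q 0 i - x0 0 i).
    exact: (smooth_on_add oD (smooth_on_coord X p i) (smooth_on_cst X _ _)).
  exact: (smooth_on_mul oD H H).
have num_s : smooth_on X (dom p) num.
  apply: (smooth_on_flat 0 oD).
  exact: (smooth_on_add oD (smooth_on_cst X _ _) (smooth_on_opp oD rho_s)).
have chi_D : smooth_on X (dom p) chi.
  have H : smooth_on X (dom p) (fun q => num q / den q).
    apply: (smooth_on_mul oD num_s); apply: (smooth_on_inv oD (fun q _ => den0 q)).
    apply: (smooth_on_add oD num_s); apply: (smooth_on_flat 0 oD).
    exact: (smooth_on_add oD rho_s (smooth_on_cst X _ _)).
  by apply: smooth_on_ext H => // q pq; rewrite /chi asboolT.
have chi_Z q : ~ Z q -> chi q = 0.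
  move=> nZ; rewrite /chi; case: asboolP => // pq.
  rewrite /num flat_le0 ?mul0r // subr_le0 leNgt; apply/negP => /ltW h.
  by apply: nZ; exists (map p q) => //; rewrite chart_mapK.
exists chi, Z, (dom p `&` [set q | rho q < r / 2]); split; split=> //.
- apply: smooth_on_local => q _; have [pq|npq] := pselect (dom p q); first by exists (dom p).
  exists (~` Z); split; first exact: closed_openC.
    by move=> /ZW [].
  apply: smooth_on_ext (smooth_on_cst X _ 0); first exact: closed_openC.
  by move=> s /chi_Z.
- by move=> q /ZW [].
- rewrite openE => q [pq hq].
  have cq := smooth_on_continuous oD rho_s (mem_set pq).
  apply: filterI; first exact: open_nbhs_nbhs.
  have N : nbhs (rho q) [set y : R | y < r / 2].
    by apply: open_nbhs_nbhs; split=> //; exact: open_lt.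
  exact: (cq _ N).
- split=> //=; rewrite /rho big1 ?divr_gt0 // => i _.
  by rewrite /x0 subrr expr0n.
- move=> q [pq hq]; rewrite /chi asboolT // /den (@flat_le0 _ _ (rho q - r / 2)) ?addr0.
    by rewrite divff // /num gt_eqF // flat_gt0 // subr_gt0 (lt_trans hq) // ltr_pdivrMr // ltr_pMr // ltr1n.
  by rewrite subr_le0 ltW.
Qed.

(* [good q] marks the points where no cutoff is needed. *)
Lemma cutoff_exists W (good : M -> Prop) : compact [set: M] ->
  (forall p, W p \/ exists O, [/\ open O, O p & forall q, O q -> good q]) -> open W ->
  exists chi : M -> R, [/\ smooth_on X setT chi,
    exists2 Z, closed Z /\ Z `<=` W & forall q, ~ Z q -> chi q = 0 &
    forall q, good q \/ exists O, [/\ open O, O q & forall s, O s -> chi s = 1]].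
Proof.
move=> Mc cover oW.
pose P (A : set M) := exists chi : M -> R, [/\ smooth_on X setT chi,
    exists2 Z, closed Z /\ Z `<=` W & forall q, ~ Z q -> chi q = 0 &
    forall q, A q -> good q \/ exists O, [/\ open O, O q & forall s, O s -> chi s = 1]].
have P0 : P set0.
  exists (fun=> 0); split=> //; first exact: smooth_on_cst.
  by exists set0 => //; split => //; exact: closed0.
have PU A1 A2 : P A1 -> P A2 -> P (A1 `|` A2).
  move=> [c1 [s1 [Z1 H1 z1] g1]] [c2 [s2 [Z2 H2 z2] g2]].
  move: H1 H2 => [cZ1 ZW1] [cZ2 ZW2].
  (* This is 1 - (1 - c1)(1 - c2): it equals 1 where either cutoff does, and 0 where both vanish. *)
  exists (fun q => c1 q + c2 q - c1 q * c2 q); split.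
  - apply: (smooth_on_add openT (smooth_on_add openT s1 s2)).
    exact: (smooth_on_opp openT (smooth_on_mul openT s1 s2)).
  - exists (Z1 `|` Z2); first by split; [exact: closedU|move=> q [/ZW1|/ZW2]].
    by move=> q nZ; rewrite z1 ?z2 ?mul0r ?addr0 ?subr0 // => h; apply: nZ; [right|left].
  - move=> q [/g1|/g2] => - [gq | [ O [oO Oq h]]]; try (by left); right; exists O; split=> // s /h ->; ring.
have Ploc p : exists O, [/\ open O, O p & P O].
  have [Wp|[ O [oO Op gO]]] := cover p.
    have [chi [Z [ O [[h1 h2 h3 h4] [oO Op h5]]]]] := bump_exists oW Wp.
    exists O; split=> //; exists chi; split=> //; first by exists Z.
    by move=> q Oq; right; exists O.
  exists O; split=> //; exists (fun=> 0); split=> //; first exact: smooth_on_cst.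
    by exists set0 => //; split => //; exact: closed0.
  by move=> q /gO; left.
have [ O HO] := choice Ploc.
have [s cover_s] := compact_finite_cover Mc (fun p => let: And3 oO Op _ := HO p in conj oO Op).
suff [chi [h1 h2 h3]] : P [set x | exists2 p, p \in s & O p x].
  by exists chi; split=> // q; apply: h3; exact: cover_s.
elim: s {cover_s} => [|p s IH].
  have [chi [h1 h2 h3]] := P0; exists chi; split=> // q [p]; by rewrite in_nil.
have [_ _ Pp] := HO p; have [chi [h1 h2 h3]] := PU _ _ Pp IH.
exists chi; split=> // q [t]; rewrite inE => /orP[/eqP -> Opq|ts Otq]; apply: h3; first by left.
by right; exists t.
Qed.

End Cutoff.

(** * The null space of the Levi form and theta *)

Section LeviNullSpace.
Context {R : realType} {n : nat} {M : topologicalType} {X : manifold R n.*2.+1 M}.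
Context {E : CR_structure X} {g : CR_metric E} (S : CR_orientation g).
Local Notation C := R[i].
Hypothesis S_pc : pseudoconvex S.
Implicit Types (F : frame S) (p q : M).

Definition levi_nondegenerate p : Prop :=
  forall F, fdom F p -> forall xi : 'rV[C]_n, xi *m levi F p = 0 -> xi = 0.

Lemma mulmx_levi F p (xi : 'rV[C]_n) j : fdom F p ->
  (xi *m levi F p) 0 j = - dgam S p (\sum_i xi 0 i *: fL F i p) (fLbar F j p).
Proof.
move=> Fp; rewrite mxE dgam_suml -sumrN; apply: eq_bigr => i _.
by rewrite dgamZl leviE // mulrN.
Qed.

(** The null space consists of the l in T^{1,0} with d gamma(l, conj l') = 0 for all l' in T^{1,0},
    a condition without frames; eta is the coefficient row of the same l in F'. *)
Lemma null_transfer F F' p (xi : 'rV[C]_n) : fdom F p -> fdom F' p -> xi *m levi F p = 0 ->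
  exists2 eta : 'rV[C]_n, \sum_i xi 0 i *: fL F i p = \sum_i eta 0 i *: fL F' i p &
    eta *m levi F' p = 0.
Proof.
move=> Fp F'p xi0; set l := \sum_i xi 0 i *: fL F i p.
have lT : l \in T10 E p by apply: memv_suml => i _; apply: memvZ; exact: fL_T10.
have lE : l = \sum_i (\row_i herm (metric g p) l (fL F' i p)) 0 i *: fL F' i p.
  by rewrite [LHS](frame_basis F'p lT); apply: eq_bigr => i _; rewrite mxE.
exists (\row_i herm (metric g p) l (fL F' i p)) => //.
apply/rowP => j; rewrite mulmx_levi // -lE [RHS]mxE frame_fLbarE.
rewrite [fL F' j p](frame_basis Fp (fL_T10 j F'p)) conjv_sum dgam_sumr big1 ?oppr0 // => k _.
rewrite conjvZ dgamZr; have := mulmx_levi xi k Fp; rewrite xi0 mxE -/l => /eqP.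
by rewrite eq_sym oppr_eq0 => /eqP ->; rewrite mulr0.
Qed.

Lemma frame_sum_eq0 F p (xi : 'rV[C]_n) : fdom F p -> \sum_i xi 0 i *: fL F i p = 0 -> xi = 0.
Proof.
move=> Fp xi0; apply/rowP => j; rewrite mxE.
have := herm_frame_sum (fun i => xi 0 i) (fun i => (i == j)%:R) Fp.
rewrite xi0 herm0l (bigD1 j) //= eqxx rmorph1 mulr1 big1 ?addr0 // => i /negPf ->.
by rewrite rmorph0 mulr0.
Qed.

Lemma null_vector_weak F p (xi : 'rV[C]_n) : fdom F p -> xi != 0 -> xi *m levi F p = 0 ->
  weakly_pseudoconvex_pt S p.
Proof.
move=> Fp xin0 xi0; exists F => // /(_ xi xin0).
by rewrite hquad_mulmx xi0 mul0mx mxE ltxx.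
Qed.

(** A zero determinant yields a null vector, hence a failure of positive definiteness; a nonzero one
    stays nonzero nearby, and [null_transfer] passes to other frames. *)
Lemma weak_or_nondegenerate p : weakly_pseudoconvex_pt S p \/
  exists O, [/\ open O, O p & forall q, O q -> levi_nondegenerate q].
Proof.
have [F Fp] := frame_exists S p.
have [/det0P[v v0 vl]|dn0] := boolP (\det (levi F p) == 0).
  by left; exact: null_vector_weak Fp v0 vl.
right; have oF := fdom_open F.
have [dr di] := csmooth_on_det oF (smooth_levi F).
pose N q := complex.Re (\det (levi F q)) ^+ 2 + complex.Im (\det (levi F q)) ^+ 2.
have Ns : smooth_on X (fdom F) N.
  exact: (smooth_on_add oF (smooth_on_mul oF dr dr) (smooth_on_mul oF di di)).
exists (fdom F `&` [set q | 0 < N q]); split.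
- rewrite openE => q [Fq hq]; have cq := smooth_on_continuous oF Ns (mem_set Fq).
  apply: filterI; first exact: open_nbhs_nbhs.
  have Nq : nbhs (N q) [set y : R | 0 < y].
    by apply: open_nbhs_nbhs; split=> //; exact: open_gt.
  exact: (cq _ Nq).
- split=> //=; rewrite lt_def addr_ge0 ?sqr_ge0 // andbT.
  apply: contra dn0; rewrite paddr_eq0 ?sqr_ge0 // !expf_eq0 /= => /andP[/eqP r0 /eqP i0].
  exact/eqP/complexP.
- move=> q [Fq Nq] F' F'q xi xi0.
  have [eta eE eta0] := null_transfer F'q Fq xi0.
  apply: (frame_sum_eq0 F'q); rewrite eE.
  suff -> : eta = 0 by apply: big1 => i _; rewrite mxE scale0r.
  have lu : levi F q \in unitmx.
    rewrite unitmxE unitfE; apply: contraTneq Nq => d0.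
    by rewrite /N /= d0 /= expr0n addr0 ltxx.
  by rewrite -[eta](mulmxK lu) eta0 mul0mx.
Qed.

(** A nonzero null vector makes p weakly pseudoconvex and excludes the nondegenerate alternative.
    Then H and h have the same differential at p, and dh = alpha on the null space. *)
Lemma theta_kills_null (H h : M -> R) F p (xi : 'rV[C]_n) :
  (forall q, weakly_pseudoconvex_pt S q -> forall v, levi_null S q v ->
     tact X q v (cfun h) = Defs.pair (alpha S (Tvf S) q) v) ->
  levi_nondegenerate p \/ (exists O, [/\ open O, O p & forall s, O s -> H s = h s]) ->
  fdom F p -> xi *m levi F p = 0 -> xi *m \col_i theta S H p (fL F i p) = 0.
Proof.
move=> exact_h alt Fp xi0.
have [->|xin0] := eqVneq xi 0; first by rewrite mul0mx.
case: alt => [nd|[ O [oO Op HO]]].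
  by rewrite (nd F Fp xi xi0) mul0mx.
have wp := null_vector_weak Fp xin0 xi0.
pose l := \sum_i xi 0 i *: fL F i p.
have lnull : levi_null S p l by exists F => //; exists xi.
apply/rowP => j; rewrite ord1 mxE [RHS]mxE.
have -> : \sum_j xi 0 j * (\col_i theta S H p (fL F i p)) j 0 = theta S H p l.
  by rewrite theta_sum; apply: eq_bigr => i _; rewrite mxE.
rewrite /theta -(exact_h p wp l lnull).
rewrite (@tact_ext _ _ _ X p O l (cfun H) (cfun h) oO Op) ?subrr ?mulr0 // => s /HO.
by rewrite /cfun => ->.
Qed.

End LeviNullSpace.

(** * Uniform smallness of alpha_eps *)

Section UniformEstimate.
Context {R : realType} {n : nat} {M : topologicalType} {X : manifold R n.*2.+1 M}.
Context {E : CR_structure X} {g : CR_metric E} (S : CR_orientation g).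
Local Notation C := R[i].
Hypothesis S_pc : pseudoconvex S.
Variable H : M -> R.
Hypothesis H_smooth : smooth_on X setT H.
Hypothesis theta_null : forall (F : frame S) p, fdom F p -> forall xi : 'rV[C]_n,
  xi *m levi F p = 0 -> xi *m \col_i theta S H p (fL F i p) = 0.

Lemma ge0_Re (z : C) : 0 <= z -> z = (complex.Re z)%:C.
Proof. by move=> z0; apply: complexP => //=; exact: ger0_Im. Qed.

(** The neighbourhood serves every d up to d0 and every frame at once, so a finite subcover allows
    the smallest d0 to be used everywhere. *)
Lemma alpha_sqnorm_local (eta : R) p : 0 < eta -> exists O d0, [/\ open O, O p, 0 < d0 &
  forall q d, O q -> 0 < d <= d0 -> forall F : frame S, fdom F q ->
    alpha_sqnorm F (Teps S H d) q <= eta%:C].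
Proof.
move=> eta0; have [F Fp] := frame_exists S p.
have oF := fdom_open F.
pose th q := \col_i theta S H q (fL F i q).
have [w wE] := left_kernel_range (theta_null Fp).
pose e q := th q - levi F q *m w.
pose N q := sqnorm (e q)^T.
have Ns : csmooth_on X (fdom F) N.
  have Ne i : csmooth_on X (fdom F) (fun q => e q i 0).
    have H1 : csmooth_on X (fdom F) (fun q => theta S H q (fL F i q) - \sum_j levi F q i j * w j 0).
      apply: (csmooth_on_sub oF (smooth_theta H_smooth F i)).
      apply: (csmooth_on_sum _ oF) => j.
      exact: (csmooth_on_mul oF (smooth_levi F i j) (csmooth_on_cst X _ _)).
    by apply: csmooth_on_ext H1 => // q _; rewrite /e /th !mxE.
  have H2 : csmooth_on X (fdom F) (fun q => \sum_i e q i 0 * Num.conj (e q i 0)).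
    apply: (csmooth_on_sum _ oF) => i.
    exact: (csmooth_on_mul oF (Ne i) (csmooth_on_conj oF (Ne i))).
  apply: csmooth_on_ext H2 => // q _; apply: eq_bigr => i _.
  by rewrite [in RHS]mxE normCK.
have [Nr _] := Ns.
pose sw := complex.Re (sqnorm w^T).
have swE : sqnorm w^T = sw%:C by apply: ge0_Re; exact: sqnorm_ge0.
have sw0 : 0 <= sw by rewrite -ler0c -swE sqnorm_ge0.
have eta8 : 0 < eta / 8 by rewrite divr_gt0.
(* This forces d^2 |w|^2 <= d (1 + |w|^2) <= eta/8 for d <= d0: the bound by 1 serves the first
   inequality, and 1 + |w|^2 is a safe divisor. *)
pose d0 := Num.min 1 (eta / 8 / (1 + sw)).
have d00 : 0 < d0 by rewrite lt_min ltr01 /= divr_gt0 // ltr_pwDl.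
exists (fdom F `&` [set q | complex.Re (N q) < eta / 8]), d0; split=> //.
- rewrite openE => q [Fq hq]; have cq := smooth_on_continuous oF Nr (mem_set Fq).
  apply: filterI; first exact: open_nbhs_nbhs.
  have Nq : nbhs (complex.Re (N q)) [set y : R | y < eta / 8].
    by apply: open_nbhs_nbhs; split=> //; exact: open_lt.
  exact: (cq _ Nq).
- split=> //=; rewrite /N /e /th wE subrr /sqnorm big1 ?eta8 // => j _.
  by rewrite !mxE normr0 expr0n.
- move=> q d [Fq hq] /andP[dpos dd0] F' F'q.
  rewrite (alpha_sqnorm_Teps H_smooth S_pc dpos F'q).
  rewrite (sqnorm_reg_coef_frame H S_pc dpos F'q Fq).
  have := shifted_solution_bound w (e q) (S_pc Fq) dpos.
  have -> : levi F q *m w + e q = th q by rewrite /e addrC subrK.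
  move=> bd.
  have dsw : d ^+ 2 * sw <= eta / 8.
    have d1 : d <= 1 by rewrite (le_trans dd0) // ge_min lexx.
    have d2 : d * (1 + sw) <= eta / 8.
      by rewrite -ler_pdivlMr ?ltr_pwDl // (le_trans dd0) // ge_min lexx orbT.
    apply: le_trans d2; rewrite expr2 -mulrA ler_pM2l //.
    apply: (@le_trans _ _ sw); last by rewrite lerDr.
    by rewrite ler_piMl.
  have NE : N q = (complex.Re (N q))%:C by apply: ge0_Re; exact: sqnorm_ge0.
  (* One factor 2 is from the norm of alpha, the other from the solution bound; hence 4 (eta/8 +
     eta/8) = eta. *)
  apply: (@le_trans _ _ (2 * (2 * (d%:C ^+ 2 * sqnorm w^T + N q)))).
    by rewrite ler_pM2l ?ltr0n.
  rewrite swE NE -rmorphXn -rmorphM -rmorphD -(rmorph_nat (real_complex R) 2) -!rmorphM lecR /=.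
  by move: dsw hq => /=; lra.
Qed.

Lemma alpha_sqnorm_uniform (eta : R) : compact [set: M] -> 0 < eta -> exists2 d : R, 0 < d &
  forall (F : frame S) q, fdom F q -> alpha_sqnorm F (Teps S H d) q <= eta%:C.
Proof.
move=> Mc eta0.
have [ O HO] := choice (fun p => alpha_sqnorm_local p eta0).
have [d Hd] := choice HO.
have [s cover_s] : exists s : seq M, forall x, exists2 p, p \in s & O p x.
  by apply: compact_finite_cover => // p; have [] := Hd p.
have [d1 d1pos d1s] : exists2 d1 : R, 0 < d1 & forall p, p \in s -> d1 <= d p.
  elim: s {cover_s} => [|p s [d1 d1pos IH]]; first by exists 1.
  exists (Num.min (d p) d1) => [|t]; first by have [_ _ dp _] := Hd p; rewrite lt_min dp d1pos.
  by rewrite inE => /orP[/eqP->|/IH h]; rewrite ge_min ?lexx // h orbT.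
exists d1 => // F q Fq; have [p ps Oq] := cover_s q; have [_ _ _ bd] := Hd p.
by apply: bd => //; rewrite d1pos d1s.
Qed.

End UniformEstimate.

Lemma smooth_bounded (R : realType) (m : nat) (M : topologicalType) (X : manifold R m M)
    (f : M -> R) : compact [set: M] -> smooth_on X setT f -> exists B : R, forall p, `|f p| <= B.
Proof.
move=> Mc fs; have cf : {in [set: M], continuous f} by exact: (smooth_on_continuous openT fs).
have : compact (f @` [set: M]).
  by apply: continuous_compact => //; apply: continuous_in_subspaceT => x; exact: cf.
move=> /compact_bounded [B [_ HB]]; exists (B + 1) => p.
by apply: (HB (B + 1)); [rewrite ltrDl|exists p].
Qed.

(** The function h is uncontrolled outside W, but chi vanishes off a closed Z inside W, so chi h is
    smooth both on W and on the complement of Z, which together cover M. *)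
Lemma exact_potential (R : realType) (n : nat) (M : topologicalType) (X : manifold R n.*2.+1 M)
    (E : CR_structure X) (g : CR_metric E) (S : CR_orientation g) :
  compact [set: M] -> pseudoconvex S -> alpha_exact_on_null S ->
  exists2 H : M -> R, smooth_on X setT H &
    forall (F : frame S) p, fdom F p -> forall xi : 'rV[R[i]]_n,
      xi *m levi F p = 0 -> xi *m \col_i theta S H p (fL F i p) = 0.
Proof.
move=> Mc PC [W [h [oW KW h_s h_exact]]].
have cover p : W p \/ exists O, [/\ open O, O p & forall q, O q -> levi_nondegenerate S q].
  by have [/KW|] := weak_or_nondegenerate S p; [left|right].
have [chi [chi_s [Z [cZ ZW] chi_Z] chi_1]] := cutoff_exists X Mc cover oW.
exists (fun p => chi p * h p).
  apply: smooth_on_local => p _; have [Wp|nWp] := pselect (W p).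
    exists W; split=> //; apply: (smooth_on_mul oW _ h_s).
    by apply: smooth_on_subset chi_s.
  exists (~` Z); split; [exact: closed_openC|by move=> /ZW|].
  apply: smooth_on_ext (smooth_on_cst X _ 0); first exact: closed_openC.
  by move=> q /chi_Z ->; rewrite mul0r.
move=> F p Fp xi xi0; apply: (theta_kills_null h_exact _ Fp xi0).
have [nd|[ O [oO Op O1]]] := chi_1 p; [by left|right; exists O; split=> // s /O1 ->].
by rewrite mul1r.
Qed.

Theorem corollary1p3 (R : realType) (n : nat) (hn : (2 <= n)%N)
    (M : topologicalType) (X : manifold R n.*2.+1 M) (E : CR_structure X)
    (g : CR_metric E) (S : CR_orientation g)
    (M_compact : compact [set: M])
    (M_pseudoconvex : pseudoconvex S)
    (M_psh : exists lam : M -> R,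
       smooth_on X [set: M] lam /\ strictly_CR_psh S lam)
    (M_exact : alpha_exact_on_null S) :
  exists B b : R, 0 < b /\
  forall eps : R, 0 < eps ->
  exists (lam : M -> R) (Teps : vfield R n.*2.+1 M) (A : R),
    [/\ smooth_on X [set: M] lam,
        smooth_vf X [set: M] Teps /\ (forall p, conjv (Teps p) = - Teps p),
        0 < A,
        forall p, `|lam p| <= B /\
          b%:C <= `|pair (gam S p) (Teps p)| <= B%:C &
        forall u, form01 S u -> forall (F : frame S) p, fdom F p ->
          (eps^-1)%:C * alpha_sqnorm F Teps p * sqnorm (coef01 F u p)
            <= hquad (levi_fun F lam p + A%:C *: levi F p) (coef01 F u p)].
Proof.
have [lam [lam_s [a a0 lam_psh]]] := M_psh.
have [H H_s H_null] := exact_potential M_compact M_pseudoconvex M_exact.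
have [B1 HB1] := smooth_bounded M_compact lam_s.
have [B2 HB2] := smooth_bounded M_compact H_s.
(* Here |lam| <= B1 and |H| <= B2, while gamma(T_eps) = e^H. *)
exists (Num.max B1 (expR B2)), (expR (- B2)); split; first exact: expR_gt0.
move=> eps eps0.
(* The target eps * a makes eps^-1 |alpha_eps|^2 at most a, the constant of strict
   plurisubharmonicity of lam. *)
have [d d0 Hd] := alpha_sqnorm_uniform M_pseudoconvex H_s H_null M_compact (mulr_gt0 eps0 a0).
exists lam, (Teps S H d), 1; split=> //.
- by split; [exact: (smooth_Teps H_s M_pseudoconvex d0)|exact: Teps_imag].
- move=> p; split; first by rewrite le_max HB1.
  rewrite (gam_Teps H M_pseudoconvex p d0).
  have -> : `|(expR (H p))%:C : R[i]| = (expR (H p))%:C.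
    by apply: ger0_norm; rewrite ler0c expR_ge0.
  have := HB2 p; rewrite ler_norml => /andP[h1 h2].
  by rewrite !lecR le_max !ler_expR h1 h2 orbT.
- move=> u u01 F p Fp; rewrite scale1r.
  apply: le_trans (lam_psh u u01 F p Fp); apply: ler_wpM2r; first exact: sqnorm_ge0.
  have -> : a%:C = (eps^-1)%:C * (eps * a)%:C.
    by rewrite -rmorphM mulKf // gt_eqF.
  apply: ler_wpM2l; first by rewrite ler0c invr_ge0 ltW.
  exact: Hd.
Qed.
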